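(* For each integer $n\ge 1$, let $1\le m_n\le N_n$ be integers, let $X_{n,1},\ldots,X_{n,N_n}$ be real random variables defined on a common probability space (which may depend on $n$), and let $S_n=\sum_{i=1}^{N_n}X_{n,i}$. Suppose that, for every $n$, the finite sequence $(X_{n,1},\ldots,X_{n,N_n})$ is $m_n$-dependent, and that $E(X_{n,i})=0$, $E(X_{n,i}^2)<\infty$ and $\sigma_n^2:=E(S_n^2)>0$ for all $n$ and $i$ (with $\sigma_n>0$). For $c>0$ define $$U_n(c)=\frac{m_n}{\sigma_n^2}\sum_{i=1}^{N_n}E\Bigl[X_{n,i}^2\,1\bigl\{|X_{n,i}|>c\,\sigma_n/m_n\bigr\}\Bigr].$$ Let $Z$ be a standard normal random variable. Then $$d_W\Bigl(\frac{S_n}{\sigma_n},\,Z\Bigr)\le 30\,\bigl\{c^{1/3}+12\,U_n(c/2)^{1/2}\bigr\}$$ for all $n\ge 1$ and all $c>0$.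
   Context: For an integer $k\ge 0$, a (finite or infinite) sequence $(Y_i)$ of random variables is $k$-dependent if $(Y_i:i\le j)$ is independent of $(Y_i:i>j+k)$ for every $j$. For real random variables $X,Y$ with $E|X|+E|Y|<\infty$, the Wasserstein distance between their distributions is $d_W(X,Y)=\inf E|U-V|$, the infimum being over pairs $(U,V)$ of real random variables defined on the same probability space with $U\sim X$ and $V\sim Y$. Equivalently, $d_W(X,Y)=\int_{-\infty}^\infty|P(X\le t)-P(Y\le t)|\,dt=\sup_f|Ef(X)-Ef(Y)|$, the supremum being over 1-Lipschitz functions $f:\mathbb{R}\to\mathbb{R}$. *)

(* Defs.v *)
From HB Require Import structures.
From mathcomp Require Import all_boot all_order all_algebra.
From mathcomp Require Import all_classical all_reals all_analysis.
From mathcomp Require Import measurable_realfun.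

Set Implicit Arguments.
Unset Strict Implicit.
Unset Printing Implicit Defensive.

Import Order.TTheory GRing.Theory Num.Theory.
Import numFieldNormedType.Exports.

Local Open Scope classical_set_scope.
Local Open Scope ring_scope.

Definition sigma_family d (T : measurableType d) (R : realType)
    (P : probability T R) (N : nat) (Y : 'I_N -> {RV P >-> R})
    (A : set 'I_N) : set (set T) :=
  <<s \bigcup_(i in A) g_sigma_algebra_preimage (Y i) >>.

Definition independent_families d (T : measurableType d) (R : realType)
    (P : probability T R) (N : nat) (Y : 'I_N -> {RV P >-> R})
    (A B : set 'I_N) : Prop :=
  forall E F : set T, sigma_family Y A E -> sigma_family Y B F ->
    P (E `&` F) = (P E * P F)%E.

(* Indices start at 0 here: shifting j by one gives the same condition as for
   indices starting at 1, as an empty subfamily is independent of any other. *)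
Definition k_dependent d (T : measurableType d) (R : realType)
    (P : probability T R) (N : nat) (k : nat) (Y : 'I_N -> {RV P >-> R}) :=
  forall j : nat, independent_families Y
    [set i : 'I_N | (i <= j)%N] [set i : 'I_N | (j + k < i)%N].

(* X and Y may live on different probability spaces, and (U, V) on a third one.
   The value is meaningful as a distance when X and Y are integrable. *)
Definition wasserstein d1 d2 (T1 : measurableType d1) (T2 : measurableType d2)
    (R : realType) (P1 : probability T1 R) (P2 : probability T2 R)
    (X : {RV P1 >-> R}) (Y : {RV P2 >-> R}) : \bar R :=
  ereal_inf [set e : \bar R |
    exists (d : measure_display) (T : measurableType d) (Q : probability T R)
           (U V : {RV Q >-> R}),
      [/\ distribution Q U = distribution P1 X,
          distribution Q V = distribution P2 Y &
          e = ('E_Q[fun x => `|U x - V x|%R])%E]].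

Definition partial_sum d (T : measurableType d) (R : realType)
    (P : probability T R) (N : nat) (X : 'I_N -> {RV P >-> R}) : {RV P >-> R} :=
  \sum_(i < N) (X i : {mfun T >-> R}).

Definition sigma_sum d (T : measurableType d) (R : realType)
    (P : probability T R) (N : nat) (X : 'I_N -> {RV P >-> R}) : R :=
  Num.sqrt (fine 'E_P[fun x => partial_sum X x ^+ 2]).

Definition normalized_sum d (T : measurableType d) (R : realType)
    (P : probability T R) (N : nat) (X : 'I_N -> {RV P >-> R}) : {RV P >-> R} :=
  (sigma_sum X)^-1 \o* partial_sum X.

Definition Utail d (T : measurableType d) (R : realType)
    (P : probability T R) (N : nat) (X : 'I_N -> {RV P >-> R})
    (m : nat) (c : R) : \bar R :=
  ((m%:R / sigma_sum X ^+ 2)%:E *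
   \sum_(i < N) 'E_P[fun x => (X i x ^+ 2 *
      \1_[set y | (c * sigma_sum X / m%:R < `|X i y|)%R] x)%R])%E.

(* Main.v *)
(** Cut the sum into blocks of m terms, so that the dependence has range one,
    after replacing each variable by its centred truncation at half the level
    c sigma / m; the range of dependence bounds the variance of the remainder by
    3 U_n(c/2) sigma^2.  The blocks Y_k are then bounded by c sigma, but the sum
    of their variances is not controlled by the variance of S.  It is not needed:
    the last summands are removed in groups, each group being the shortest one
    that lowers the variance of the partial sum by 95 c^2 sigma^2.  All tail sums
    inside a group have variance at most 100 c^2 sigma^2, hence (stopping and
    restarting at the first large value) a third moment of order (c sigma)^3.
    A Lindeberg replacement of each group by a Gaussian increment costs a multiple
    of c^3 times the Lipschitz constant of the second derivative of the test
    function, and there are at most a multiple of c^-2 groups.  Smoothing a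
    1-Lipschitz function at scale e = 8 c^(1/3) makes that constant 4 / e^2 at the
    price of an error e, so the total is of order c^(1/3).  The quantile coupling
    turns the bound for test functions into one for the Wasserstein distance. *)

Require Import Defs.
From HB Require Import structures.
From mathcomp Require Import all_boot all_order all_algebra.
From mathcomp Require Import all_classical all_reals all_analysis.
From mathcomp Require Import measurable_realfun ring lra zify.

Set Implicit Arguments.
Unset Strict Implicit.
Unset Printing Implicit Defensive.

Import Order.TTheory GRing.Theory Num.Theory.
Import numFieldNormedType.Exports.

Local Open Scope classical_set_scope.
Local Open Scope ring_scope.

(** * Expectations of real random variables *)

(** The variances of the partial sums need not increase, so exchanging terms one at a time could
    call for a Gaussian increment of negative variance. A group is therefore closed only once the
    variance has dropped by a definite amount, and that drop is the variance of the increment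
    replacing it. The drop contains twice the covariance across the cut, which is exactly what the
    first-order Taylor term contributes when the dependence is resolved. The Gaussians are never
    built beside the given variables: those already exchanged are recorded as the time [r] of the
    heat flow applied to the test function. All times share the same Taylor constant, so the
    induction passes from [G0 r] to [G0] at a later time and keeps a sum of fewer terms. The third
    moment of a group cannot be read off from its variance alone: restarting after a large value
    leaves a shorter tail, whose variance may be larger than that of the whole group. This is why a
    group is the shortest possible one: it makes every tail inside it small. *)

Section real_expectation.
Context d {T : measurableType d} {R : realType} (P : probability T R).
Implicit Types U V W : T -> R.

Definition Ex U : R := \int[P]_x U x.

(** Closed under sums, products and Lipschitz maps, this class gives the integrability of every
    expression in the bounded blocks. *)
Definition bm U := measurable_fun setT U /\ exists K, forall x, `|U x| <= K.

Definition intble U := P.-integrable setT (EFin \o U).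

Lemma bm_int U : bm U -> intble U.
Proof.
move=> [mU [K hK]]; apply: measurable_bounded_integrable => //.
  by rewrite (le_lt_trans (probability_le1 _ _))// ltry.
by exists K; split; [exact: num_real|move=> x Kx y _; exact: (le_trans (hK y) (ltW Kx))].
Qed.

Lemma bm_cst k : bm (fun=> k).
Proof. by split; [exact: measurable_cst|exists `|k|]. Qed.

Lemma bmD U V : bm U -> bm V -> bm (fun x => U x + V x).
Proof.
move=> [mU [K hK]] [mV [L hL]]; split; first exact: measurable_funD.
by exists (K + L) => x; rewrite (le_trans (ler_normD _ _))// lerD.
Qed.

Lemma bmM U V : bm U -> bm V -> bm (fun x => U x * V x).
Proof.
move=> [mU [K hK]] [mV [L hL]]; split; first exact: measurable_funM.
by exists (K * L) => x; rewrite normrM ler_pM.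
Qed.

Lemma bmN U : bm U -> bm (fun x => - U x).
Proof.
move=> [mU [K hK]]; split; first exact: measurableT_comp.
by exists K => x; rewrite normrN.
Qed.

Lemma bmB U V : bm U -> bm V -> bm (fun x => U x - V x).
Proof. by move=> bU bV; apply: bmD => //; exact: bmN. Qed.

Lemma bm_norm U : bm U -> bm (fun x => `|U x|).
Proof.
move=> [mU [K hK]]; split; first exact: measurableT_comp.
by exists K => x; rewrite normr_id.
Qed.

Lemma bmX U n : bm U -> bm (fun x => U x ^+ n).
Proof.
move=> bU; elim: n => [|n IH]; first exact: bm_cst.
by rewrite (_ : (fun x => _) = fun x => U x * U x ^+ n);
  [exact: bmM|apply/funext => x; rewrite exprS].
Qed.

Lemma bm_sum (I : Type) (r : seq I) (p : pred I) (F : I -> T -> R) :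
  (forall i, p i -> bm (F i)) -> bm (fun x => \sum_(i <- r | p i) F i x).
Proof.
move=> h; elim: r => [|i r IH].
  by under eq_fun do rewrite big_nil; exact: bm_cst.
under eq_fun do rewrite big_cons.
by case pi : (p i) => //; apply: bmD => //; exact: h.
Qed.

Lemma bm_lip L (g : R -> R) U : (forall x y, `|g x - g y| <= L * `|x - y|) ->
  continuous g -> bm U -> bm (g \o U).
Proof.
move=> gL cg [mU [K hK]]; split.
  by apply: measurableT_comp => //; exact: continuous_measurable_fun.
have L0 : 0 <= L by have := gL 1 0; rewrite subr0 normr1 mulr1; apply: le_trans.
exists (`|g 0| + L * K) => x /=.
have := gL (U x) 0; rewrite subr0 => h.
rewrite -[g (U x)](subrK (g 0)) (le_trans (ler_normD _ _))// addrC lerD2l.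
by rewrite (le_trans h)// ler_wpM2l.
Qed.

Lemma ExD U V : intble U -> intble V -> Ex (fun x => U x + V x) = Ex U + Ex V.
Proof. by move=> iU iV; exact: RintegralD. Qed.

Lemma ExB U V : intble U -> intble V -> Ex (fun x => U x - V x) = Ex U - Ex V.
Proof. by move=> iU iV; exact: RintegralB. Qed.

Lemma ExZ k U : intble U -> Ex (fun x => k * U x) = k * Ex U.
Proof. by move=> iU; exact: RintegralZl. Qed.

Lemma Ex_cst k : Ex (fun=> k) = k.
Proof. by rewrite /Ex Rintegral_cst//= probability_setT mulr1. Qed.

Lemma Ex_ge0 U : (forall x, 0 <= U x) -> 0 <= Ex U.
Proof. by move=> U0; apply: Rintegral_ge0. Qed.

Lemma le_Ex U V : intble U -> intble V -> (forall x, U x <= V x) ->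
  Ex U <= Ex V.
Proof. by move=> iU iV UV; apply: le_Rintegral. Qed.

Lemma Ex_norm U : intble U -> `|Ex U| <= Ex (fun x => `|U x|).
Proof. by move=> iU; apply: le_normr_Rintegral. Qed.

Lemma intbleD U V : intble U -> intble V -> intble (fun x => U x + V x).
Proof.
move=> iU iV; rewrite /intble.
rewrite (_ : _ \o _ = ((EFin \o U) \+ (EFin \o V))%E); first exact: integrableD.
by apply/funext.
Qed.

Lemma intbleZ k U : intble U -> intble (fun x => k * U x).
Proof.
move=> iU; rewrite /intble (_ : _ \o _ = (fun x => k%:E * (EFin \o U) x)%E).
  exact: integrableZl.
by apply/funext.
Qed.

Lemma intbleB U V : intble U -> intble V -> intble (fun x => U x - V x).
Proof.
move=> iU iV; rewrite (_ : (fun x => _) = fun x => U x + (-1) * V x).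
  by apply: intbleD => //; exact: intbleZ.
by apply/funext => x; rewrite mulN1r.
Qed.

Lemma intble_norm U : intble U -> intble (fun x => `|U x|).
Proof. by move=> iU; exact: (integrable_abse iU). Qed.

Lemma intble_meas U : intble U -> measurable_fun setT U.
Proof. by move=> /integrableP[/measurable_EFinP]. Qed.

Lemma le_intble U V : measurable_fun setT U -> intble V ->
  (forall x, `|U x| <= V x) -> intble U.
Proof.
move=> mU iV UV; apply: (le_integrable _ _ _ iV) => //.
- exact/measurable_EFinP.
- by move=> x _ /=; rewrite lee_fin (le_trans (UV x))// ler_norm.
Qed.

Lemma Ex_sum (I : Type) (r : seq I) (p : pred I) (F : I -> T -> R) :
  (forall i, p i -> intble (F i)) ->
  intble (fun x => \sum_(i <- r | p i) F i x) /\
  Ex (fun x => \sum_(i <- r | p i) F i x) = \sum_(i <- r | p i) Ex (F i).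
Proof.
move=> h; elim: r => [|i r [IH1 IH2]].
  under eq_fun do rewrite big_nil; split; first exact: bm_int (bm_cst _).
  by rewrite Ex_cst big_nil.
rewrite big_cons; under eq_fun do rewrite big_cons.
case pi : (p i) => //; split; first by apply: intbleD => //; exact: h.
by rewrite ExD ?IH2//; exact: h.
Qed.

Lemma Ex_close U V b : intble U -> intble V ->
  (forall x, `|U x - V x| <= b) -> `|Ex U - Ex V| <= b.
Proof.
move=> iU iV UV; rewrite -ExB// (le_trans (Ex_norm _))//; first exact: intbleB.
rewrite -[leRHS]Ex_cst; apply: le_Ex => //; last exact: bm_int (bm_cst _).
by apply: intble_norm; exact: intbleB.
Qed.

Lemma Ex_close_le U V W : intble U -> intble V -> intble W ->
  (forall x, `|U x - V x| <= W x) -> `|Ex U - Ex V| <= Ex W.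
Proof.
move=> iU iV iW UV; rewrite -ExB// (le_trans (Ex_norm _))//; first exact: intbleB.
by apply: le_Ex => //; apply: intble_norm; exact: intbleB.
Qed.

Lemma intble_sqr U : measurable_fun setT U -> intble (fun x => U x ^+ 2) ->
  intble U.
Proof.
move=> mU iU; apply: (le_intble (V := fun x => 1 + U x ^+ 2)) => //.
  by apply: intbleD => //; exact: bm_int (bm_cst _).
move=> x; rewrite ler_norml; have := sqr_ge0 (U x - 1); have := sqr_ge0 (U x + 1).
nra.
Qed.

Lemma intbleM U V : measurable_fun setT U -> measurable_fun setT V ->
  intble (fun x => U x ^+ 2) -> intble (fun x => V x ^+ 2) ->
  intble (fun x => U x * V x).
Proof.
move=> mU mV iU iV; apply: (le_intble (V := fun x => U x ^+ 2 + V x ^+ 2)).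
- exact: measurable_funM.
- exact: intbleD.
- move=> x; rewrite ler_norml.
  have := sqr_ge0 (U x - V x); have := sqr_ge0 (U x + V x).
  by rewrite sqrrB sqrrD; have := sqr_ge0 (U x); have := sqr_ge0 (V x); nra.
Qed.

(** Integrating 2 t |U| <= U^2 + t^2 and choosing t = E|U| gives (E|U|)^2 <= s^2. *)
Lemma Ex_norm_le U s : measurable_fun setT U -> intble (fun x => U x ^+ 2) ->
  0 <= s -> Ex (fun x => U x ^+ 2) <= s ^+ 2 -> Ex (fun x => `|U x|) <= s.
Proof.
move=> mU iU s0 Us.
have iU1 := intble_norm (intble_sqr mU iU).
have b1 : forall k, intble (fun=> k) by move=> k; exact: bm_int (bm_cst _).
have h t : 2 * t * Ex (fun x => `|U x|) <= s ^+ 2 + t ^+ 2.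
  rewrite -ExZ// (le_trans _ (lerD Us (lexx _)))// -[X in _ + X]Ex_cst -ExD//.
  apply: le_Ex => //; [exact: intbleZ|exact: intbleD|].
  move=> x; have := sqr_ge0 (`|U x| - t); have := real_normK (num_real (U x)).
  nra.
have e0 : 0 <= Ex (fun x => `|U x|) by apply: Ex_ge0.
set e := Ex _ in h e0 *.
rewrite leNgt; apply/negP => se; have := h e; nra.
Qed.

Lemma Ex_distribution (X : {RV P >-> R}) (g : R -> R) :
  measurable_fun setT g -> intble (g \o X) ->
  (distribution P X).-integrable setT (EFin \o g) /\
  (\int[distribution P X]_y (g y)%:E = (Ex (g \o X))%:E)%E.
Proof.
move=> mg ig; split.
  by apply: (@integrable_pushforward _ _ T _ R X (measurable_funPT X) P setT
    (EFin \o g)) => //; exact/measurable_EFinP.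
rewrite integral_distribution//; last exact/measurable_EFinP.
by rewrite /Ex /Rintegral fineK//; exact: integrable_fin_num ig.
Qed.

(** The joint law agrees with the product of the two laws on rectangles, hence as a measure; Tonelli
    then gives the integrability of the product and Fubini its integral. *)
Lemma Ex_prod_indep (U V : {mfun T >-> R}) :
  intble U -> intble V ->
  (forall A B : set R, measurable A -> measurable B ->
    P (U @^-1` A `&` V @^-1` B) = (P (U @^-1` A) * P (V @^-1` B))%E) ->
  Ex (fun x => U x * V x) = Ex U * Ex V.
Proof.
move=> iU iV ind.
have mUV : measurable_fun setT (fun x => (U x, V x)).
  exact: measurable_fun_pair.
pose UV : {RV P >-> (R * R)%type} :=
  MeasurableFun.Pack (MeasurableFun.Class (isMeasurableFun.Build _ _ _ _ _ mUV)).
pose k (z : R * R) : \bar R := (z.1 * z.2)%:E.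
have mk : measurable_fun setT k.
  by apply/measurable_EFinP; apply: measurable_funM;
    [exact: measurable_fst|exact: measurable_snd].
pose m1 := distribution P U; pose m2 := distribution P V.
have e2 A : measurable A -> (m1 \x m2)%E A = distribution P UV A.
  move=> mA; apply: (@product_measure_unique _ _ _ _ _ m1 m2 (distribution P UV)) => [B C mB mC|//].
  exact: ind.
have [im1 fm1] := Ex_distribution (@measurable_id _ _ setT) iU.
have [im2 fm2] := Ex_distribution (@measurable_id _ _ setT) iV.
have mabs : measurable_fun setT (fun x : R => `|x|%:E).
  by apply/measurable_EFinP; exact: normr_measurable.
have ik : (m1 \x m2)%E.-integrable setT k.
  apply/integrable12ltyP => //.
  under eq_integral => x _.
    under eq_integral do rewrite /k/= normrM EFinM.
    rewrite ge0_integralZl//.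
    over.
  rewrite ge0_integralZr//.
  - apply: lte_mul_pinfty.
    + exact: integral_ge0.
    + exact: integrable_fin_num (integrable_abse im1).
    + by move/integrableP : im2 => [].
  - exact: integral_ge0.
have ik' : P.-integrable setT (k \o UV).
  apply/integrableP; split; first exact: measurableT_comp.
  move/integrableP : ik => [_]; apply: le_lt_trans.
  rewrite (eq_measure_integral (distribution P UV)) => [|A mA _]; last exact: e2.
  by rewrite ge0_integral_pushforward//; exact: measurableT_comp.
have e1 : (\int[P]_x (U x * V x)%:E = \int[m1 \x m2]_z k z)%E.
  rewrite (eq_measure_integral (distribution P UV)) => [|A mA _]; last exact: e2.
  by rewrite integral_pushforward.
rewrite {1}/Ex /Rintegral e1 -integral12_prod_meas1//.
rewrite (_ : (\int[m1]_x _)%E = (Ex U * Ex V)%:E)//.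
under eq_integral => x _.
  rewrite /fubini_F; under eq_integral do rewrite /k/= EFinM.
  rewrite integralZl//= fm2; over.
by rewrite integralZr//= fm1.
Qed.
End real_expectation.

Lemma Ex_sum_bm d (T : measurableType d) (R : realType) (P : probability T R)
    (I : Type) (r : seq I) (p : pred I) (F : I -> T -> R) :
  (forall i, p i -> bm (F i)) ->
  Ex P (fun x => \sum_(i <- r | p i) F i x) = \sum_(i <- r | p i) Ex P (F i).
Proof. by move=> h; apply: (Ex_sum _ _).2 => i /h /bm_int. Qed.

Ltac bm_tac := repeat first
  [ assumption | apply: bmM | apply: bmB | apply: bmD | apply: bm_norm
  | apply: bmX | apply: bmN | apply: bm_cst | by eauto ].

Ltac int_tac := apply: bm_int; bm_tac.

(** * Measurability with respect to a generated sigma-algebra *)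

Section sub_sigma_algebra.
Context (T : pointedType) (R : realType) (G : set (set T)).
Implicit Types U V : T -> R.

Definition smeas U :=
  @measurable_fun _ _ (g_sigma_algebraType G) R setT U.

Lemma smeas_cst k : smeas (fun=> k).
Proof. exact: measurable_cst. Qed.

Lemma smeasD U V : smeas U -> smeas V -> smeas (fun x => U x + V x).
Proof. by move=> hU hV; apply: measurable_funD. Qed.

Lemma smeasM U V : smeas U -> smeas V -> smeas (fun x => U x * V x).
Proof. by move=> hU hV; apply: measurable_funM. Qed.

Lemma smeas_comp g U : continuous (g : R -> R) -> smeas U -> smeas (g \o U).
Proof.
move=> cg hU; apply: measurableT_comp => //.
exact: continuous_measurable_fun.
Qed.

Lemma smeas_norm U : smeas U -> smeas (fun x => `|U x|).
Proof. by move=> hU; apply: measurableT_comp. Qed.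

Lemma smeasX U n : smeas U -> smeas (fun x => U x ^+ n).
Proof. by move=> hU; apply: measurable_funX. Qed.

Lemma smeas_sum (I : Type) (r : seq I) (p : pred I) (F : I -> T -> R) :
  (forall i, p i -> smeas (F i)) -> smeas (fun x => \sum_(i <- r | p i) F i x).
Proof.
move=> h; elim: r => [|i r IH].
  by under eq_fun do rewrite big_nil; exact: smeas_cst.
under eq_fun do rewrite big_cons.
by case pi : (p i) => //; apply: smeasD => //; exact: h.
Qed.

Lemma smeas_big_seq (I : eqType) (r : seq I) (F : I -> T -> R) :
  (forall i, i \in r -> smeas (F i)) -> smeas (fun x => \sum_(i <- r) F i x).
Proof.
move=> h; under eq_fun do rewrite big_seq.
by apply: smeas_sum => i; exact: h.
Qed.

Lemma smeas_le U t : smeas U -> smeas (fun x => if U x <= t then 0 else 1).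
Proof.
move=> hU; apply: measurable_fun_if => //.
apply: measurable_fun_ler => //.
Qed.

End sub_sigma_algebra.

(** Here [s] is the sum at the stopping time, [r] the rest of the sum and [q] the rest without its
    first term. The square of [r] is dropped, and passing from [r] to [q] costs at most 2 |s| c <=
    |s| w / 5; what remains is at least 3 w (3 w - w / 5) = 8.4 w^2. *)
Lemma kolmogorov_arith (R : realType) (c w s r q : R) :
  0 < w -> 10 * c <= w -> 3 * w < `|s| -> `|r - q| <= c ->
  8 * w ^+ 2 + 2 * (s * q) <= (s + r) ^+ 2.
Proof.
move=> w0 cw ws; rewrite ler_norml => /andP[r1 r2].
suff hh : 8 * w ^+ 2 <= s ^+ 2 + 2 * s * (r - q) by have := sqr_ge0 r; lra.
have := sqr_ge0 w; have [s0|s0] := leP 0 s.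
  rewrite ger0_norm// in ws.
  have e1 : 0 <= s * (r - q + w / 10) by apply: mulr_ge0 => //; lra.
  have e2 : 0 <= (s - 3 * w) * (s + 28 / 10 * w) by apply: mulr_ge0; lra.
  lra.
rewrite ltr0_norm// in ws.
have e1 : 0 <= - s * (w / 10 - (r - q)) by apply: mulr_ge0; lra.
have e2 : 0 <= (- s - 3 * w) * (- s + 28 / 10 * w) by apply: mulr_ge0; lra.
lra.
Qed.

(** Convexity of the cube, (u + a)^3 <= 4 (u^3 + a^3), at u = 3.2 w, with 3.2^3 < 33. The 3.2 w is
    the threshold 3 w plus an overshoot and a skipped term, each at most w / 10. *)
Lemma third_arith (R : realType) (w a b : R) :
  0 < w -> 0 <= a -> 0 <= b -> b <= 32 / 10 * w + a ->
  b ^+ 3 <= 4 * (33 * w ^+ 3) + 4 * a ^+ 3.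
Proof.
move=> w0 a0 b0 h; apply: (@le_trans _ _ ((32 / 10 * w + a) ^+ 3)).
  by apply: lerXn2r => //; rewrite nnegrE; lra.
have e1 : 0 <= (32 / 10 * w + a) * (32 / 10 * w - a) ^+ 2.
  by rewrite mulr_ge0 ?sqr_ge0//; lra.
have w3 : 0 < w ^+ 3 by rewrite exprn_gt0.
lra.
Qed.

(** * Lipschitz functions and Taylor bounds *)

Section lipschitz.
Context {R : realType}.

Lemma lip_continuous (g : R -> R) L :
  (forall x y, `|g x - g y| <= L * `|x - y|) -> continuous g.
Proof.
move=> gL x; apply/cvgrPdist_lt => e e0.
have L0 : 0 <= L by have := gL 1 0; rewrite subr0 normr1 mulr1; apply: le_trans.
have d0 : 0 < e / (L + 1) by rewrite divr_gt0//; lra.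
near=> y; apply: le_lt_trans (gL x y) _.
have : `|x - y| < e / (L + 1) by near: y; exact: cvgr_dist_lt.
rewrite ltr_pdivlMr; last by lra.
have := normr_ge0 (x - y); nra.
Unshelve. all: by end_near. Qed.

Definition lip (g : R -> R) := exists L, forall x y, `|g x - g y| <= L * `|x - y|.

Lemma bm_comp d (T : measurableType d) (g : R -> R) (U : T -> R) : lip g -> bm U -> bm (fun x => g (U x)).
Proof. by move=> [L gL] bU; apply: (bm_lip gL) => //; exact: lip_continuous gL. Qed.

Lemma smeas_lip (T : pointedType) (g : R -> R) (G : set (set T)) (U : T -> R) : lip g -> smeas G U ->
  smeas G (fun x => g (U x)).
Proof. by move=> [L gL] bU; apply: smeas_comp => //; exact: lip_continuous gL. Qed.

(** Consequences of an M-Lipschitz second derivative, stated without derivatives. The Lipschitz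
    fields have unspecified constants: they serve measurability and integrability, while the
    estimates come from the first three fields. *)
Record taylor3 (M : R) (g0 g1 g2 : R -> R) := Taylor3 {
  taylor_g0 : forall x b, `|g0 (x + b) - g0 x - g1 x * b - g2 x * b ^+ 2 / 2| <=
    M * `|b| ^+ 3 / 6;
  taylor_g1 : forall x b, `|g1 (x + b) - g1 x - g2 x * b| <= M * b ^+ 2 / 2;
  taylor_g2 : forall x b, `|g2 (x + b) - g2 x| <= M * `|b|;
  lip_g0 : lip g0; lip_g1 : lip g1; lip_g2 : lip g2 }.

Lemma intble_comp d (T : measurableType d) (P : probability T R) (g : R -> R)
    (U : T -> R) : lip g -> intble P U -> intble P (fun x => g (U x)).
Proof.
move=> [L gL] iU; apply: (@le_intble _ _ _ _ _ (fun x => `|g 0| + L * `|U x|)).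
- apply: measurableT_comp; last exact: intble_meas iU.
  by apply: continuous_measurable_fun; exact: lip_continuous gL.
- apply: intbleD; first exact: bm_int (bm_cst _).
  by apply: intbleZ; exact: intble_norm.
- move=> x; rewrite -[X in `|X|](subrK (g 0)) addrC.
  by rewrite (le_trans (ler_normD _ _))// lerD2l (le_trans (gL _ _))// subr0.
Qed.

End lipschitz.

(* [G0 r x] stands for E f(x + sqrt r Z), and [G1 r], [G2 r] for its derivatives
   in x.  [heat_time] is the heat equation integrated from r to r + v; the factor
   3 is a bound for E|Z|. *)
Record heat_family (R : realType) (M : R) (G0 G1 G2 : R -> R -> R) := HeatFamily {
  heat_taylor : forall r : R, 0 <= r -> taylor3 M (G0 r) (G1 r) (G2 r);
  heat_time : forall r v w x : R, 0 <= r -> 0 <= v -> 0 <= w -> v <= w ^+ 2 ->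
    `|G0 (r + v) x - G0 r x - v / 2 * G2 r x| <= 3 * M * w ^+ 3;
  heat_lip : forall r x y : R, 0 <= r -> `|G0 r x - G0 r y| <= `|x - y|;
  heat_time_lip : forall r v w x : R, 0 <= r -> 0 <= v -> 0 <= w -> v <= w ^+ 2 ->
    `|G0 (r + v) x - G0 r x| <= 3 * w }.

(** * Sums of bounded one-dependent variables *)

Section bounded_one_dependent.
Context d {T : measurableType d} {R : realType} (P : probability T R).
(** One-dependence: [FP a] carries the terms before a, [FF a] those after a, and [Y a] itself is the
    gap. The two families are abstract because the blocks are functions of the original variables,
    and independence is known for the sigma-algebras of the latter. *)
Variables (Y : nat -> T -> R) (c : R) (FP FF : nat -> set (set T)).
Hypothesis mY : forall k, measurable_fun setT (Y k).
Hypothesis Yc : forall k x, `|Y k x| <= c.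
Hypothesis Y0 : forall k, Ex P (Y k) = 0.
Hypothesis hP : forall a k, (k < a)%N -> smeas (FP a) (Y k).
Hypothesis hF : forall a k, (a < k)%N -> smeas (FF a) (Y k).
Hypothesis hind : forall a E F, <<s FP a >> E -> <<s FF a >> F ->
  P (E `&` F) = (P E * P F)%E.

Local Notation E := (Ex P).

Definition seg_sum i j (x : T) : R := \sum_(i <= k < j) Y k x.
Local Notation D := seg_sum.

Lemma bmY k : bm (Y k).
Proof. by split; [exact: mY|exists c]. Qed.

Lemma bm_seg_sum i j : bm (D i j).
Proof. by apply: bm_sum => k _; exact: bmY. Qed.
Local Hint Resolve bmY bm_seg_sum : core.

Lemma c_ge0 : 0 <= c.
Proof. by apply: le_trans (Yc 0 point); exact: normr_ge0. Qed.

Lemma seg_sum_cat i j k x : (i <= j)%N -> (j <= k)%N -> D i k x = D i j x + D j k x.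
Proof. by move=> ij jk; rewrite /D (big_cat_nat ij jk). Qed.

Lemma seg_sum_nil i j x : (j <= i)%N -> D i j x = 0.
Proof. by move=> ji; rewrite /D big_geq. Qed.

Lemma seg_sum1 i x : D i i.+1 x = Y i x.
Proof. by rewrite /D big_nat1. Qed.

Lemma seg_sum_tail i n x : `|D i n x - D i.+1 n x| <= c.
Proof.
have [ni|ni] := leqP n i.
  by rewrite !seg_sum_nil// ?subrr ?normr0 ?c_ge0// leqW.
by rewrite (@seg_sum_cat i i.+1 n)// addrK seg_sum1.
Qed.

Lemma smeas_past i a : smeas (FP a) (D i a).
Proof.
by apply: smeas_big_seq => k; rewrite mem_index_iota => /andP[_]; exact: hP.
Qed.

Lemma smeas_future a i n : (a < i)%N -> smeas (FF a) (D i n).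
Proof.
move=> ai; apply: smeas_big_seq => k; rewrite mem_index_iota => /andP[ik _].
by apply: hF; exact: leq_trans ai ik.
Qed.

Lemma Ex_seg_sum i j : E (D i j) = 0.
Proof. by rewrite Ex_sum_bm//; apply: big1 => k _; exact: Y0. Qed.

Lemma Ex_indep a U W : smeas (FP a) U -> smeas (FF a) W -> bm U -> bm W ->
  E (fun x => U x * W x) = E U * E W.
Proof.
move=> sU sW bU bW.
pose U' : {mfun T >-> R} := MeasurableFun.Pack
  (MeasurableFun.Class (isMeasurableFun.Build _ _ _ _ _ bU.1)).
pose W' : {mfun T >-> R} := MeasurableFun.Pack
  (MeasurableFun.Class (isMeasurableFun.Build _ _ _ _ _ bW.1)).
apply: (@Ex_prod_indep _ _ _ P U' W'); [exact: bm_int|exact: bm_int|].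
move=> A B mA mB; apply: (@hind a).
- by have := sU measurableT A mA; rewrite setTI.
- by have := sW measurableT B mB; rewrite setTI.
Qed.

Lemma Ex_indep0 a U i n : smeas (FP a) U -> bm U -> (a < i)%N ->
  E (fun x => U x * D i n x) = 0.
Proof.
by move=> sU bU ai; rewrite (@Ex_indep a)// ?Ex_seg_sum ?mulr0//; exact: smeas_future.
Qed.

(* [stop i k] is the indicator that i + k is the first time at which the segment
   sum from i exceeds 3 w.  By Kolmogorov's inequality these events have total
   probability at most 1/8; restarting the sum afterwards bounds its third moment
   by 3 w^3 plus half of the analogous third moment of later segments. *)
Section third_moment.
Variables (n : nat) (w : R).
Hypotheses (w0 : 0 < w) (cw : 10 * c <= w).

Let hit i k x : R := if `|D i (i + k) x| <= 3 * w then 0 else 1.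

Fixpoint alive i k x : R :=
  if k is k'.+1 then alive i k' x * (1 - hit i k' x) else 1.

Let stop i k x := alive i k x * hit i k x.

Let bm_hit i k : bm (hit i k).
Proof.
split; last by exists 1 => x; rewrite /hit; case: ifP; rewrite ?normr0 ?normr1.
apply: measurable_fun_if => //; apply: measurable_fun_ler => //.
exact: (bm_norm (bm_seg_sum _ _)).1.
Qed.

Let bm_alive i k : bm (alive i k).
Proof. by elim: k => [|k IH] /=; bm_tac. Qed.
Local Hint Resolve bm_hit bm_alive : core.

Let bm_stop i k : bm (stop i k).
Proof. by rewrite /stop; bm_tac. Qed.
Local Hint Resolve bm_stop : core.

Let sm_hit i k : smeas (FP (i + k)) (hit i k).
Proof. by apply: smeas_le; apply: smeas_norm; exact: smeas_past. Qed.

Let sm_alive i k a : (i + k <= a)%N -> smeas (FP a) (alive i k).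
Proof.
elim: k => [|k IH] /=; first by move=> _; exact: smeas_cst.
rewrite addnS => ika; apply: smeasM; first by apply: IH; exact: ltnW.
apply: smeasD; first exact: smeas_cst.
rewrite (_ : (fun x => _) = fun x => (-1) * hit i k x); last first.
  by apply/funext => x; rewrite mulN1r.
apply: smeasM; first exact: smeas_cst.
apply: smeas_le; apply: smeas_norm.
apply: smeas_big_seq => l; rewrite mem_index_iota => /andP[_ lik].
by apply: hP; exact: leq_trans lik (ltnW ika).
Qed.

Let sm_stop i k : smeas (FP (i + k)) (stop i k).
Proof. by apply: smeasM; [exact: sm_alive|exact: sm_hit]. Qed.

Let alive01 i k x : alive i k x = 0 \/ alive i k x = 1.
Proof.
elim: k => [|k [IH|IH]] /=; first by right.
  by left; rewrite IH mul0r.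
by rewrite IH mul1r /hit; case: ifP => _; [right|left]; rewrite ?subr0 ?subrr.
Qed.

Let stop01 i k x : stop i k x = 0 \/
  [/\ stop i k x = 1, 3 * w < `|D i (i + k) x| & `|D i (i + k) x| <= 3 * w + c].
Proof.
rewrite /stop; have [->|a1] := alive01 i k x; first by left; rewrite mul0r.
rewrite a1 mul1r /hit; case: ifPn => h; [by left|right].
rewrite -ltNge in h; split => //.
case: k => [|k] in a1 h *.
  by move: h; rewrite addn0 seg_sum_nil// normr0; move: w0; lra.
move: a1 => /=; have [->|->] := alive01 i k x.
  by rewrite mul0r => /esym/eqP; rewrite oner_eq0.
rewrite mul1r /hit; case: ifPn => [h1 _|]; last first.
  by rewrite subrr => _ /esym/eqP; rewrite oner_eq0.
rewrite addnS (@seg_sum_cat _ (i + k))// ?leq_addr// seg_sum1.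
by rewrite (le_trans (ler_normD _ _))// lerD.
Qed.

Let stop_sum i k x : \sum_(l < k) stop i l x = 1 - alive i k x.
Proof.
elim: k => [|k IH]; first by rewrite big_ord0 /= subrr.
by rewrite big_ord_recr/= IH /stop; ring.
Qed.

Let stop_ge0 i k x : 0 <= stop i k x.
Proof. by have [->|[->]] := stop01 i k x. Qed.

Let kolmogorov i k : (i + k <= n)%N ->
  8 * w ^+ 2 * E (stop i k) <= E (fun x => stop i k x * D i n x ^+ 2).
Proof.
move=> ikn; set j := (i + k)%N.
(* The term j has to be skipped: only the sum from j + 1 on is independent of what happened before
   j. *)
have h0 : E (fun x => (stop i k x * D i j x) * D j.+1 n x) = 0.
  apply: (@Ex_indep0 j) => //; last by bm_tac.
  by apply: smeasM; [exact: sm_stop|exact: smeas_past].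
rewrite -[leLHS]addr0 -[X in _ + X](mulr0 2) -h0 -!ExZ; [|int_tac|int_tac].
rewrite -ExD; [|int_tac|int_tac].
apply: le_Ex; [int_tac|int_tac|move=> x].
have [->|[-> + _]] := stop01 i k x; first by rewrite !(mul0r,mulr0) addr0.
rewrite -/j => h1; rewrite (@seg_sum_cat i j n)// ?leq_addr//.
rewrite !mul1r mulr1; apply: (@kolmogorov_arith R c w) => //; exact: seg_sum_tail.
Qed.

Let third_step i k q : (i + k <= n)%N ->
  E (fun x => `|D (i + k).+1 n x| ^+ 3) <= q ->
  E (fun x => stop i k x * `|D i n x| ^+ 3) <=
    E (stop i k) * (4 * (33 * w ^+ 3 + q)).
Proof.
move=> ikn hq; set j := (i + k)%N.
have h0 : E (fun x => stop i k x * `|D j.+1 n x| ^+ 3) =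
    E (stop i k) * E (fun x => `|D j.+1 n x| ^+ 3).
  apply: (@Ex_indep j); [exact: sm_stop| |exact: bm_stop|by bm_tac].
  by apply: smeasX; apply: smeas_norm; exact: smeas_future.
apply: (@le_trans _ _ (4 * (33 * w ^+ 3) * E (stop i k) +
    4 * E (fun x => stop i k x * `|D j.+1 n x| ^+ 3))); last first.
  rewrite h0; have : 0 <= E (stop i k) by apply: Ex_ge0.
  move: hq; rewrite -/j; set e := E (fun _ => _); set f := E (stop i k) => hq f0.
  have := ler_wpM2l f0 hq; lra.
rewrite -!ExZ; [|int_tac|int_tac]; rewrite -ExD; [|int_tac|int_tac].
apply: le_Ex; [int_tac|int_tac|move=> x].
have [->|[-> _ h1]] := stop01 i k x; first by rewrite !(mul0r,mulr0) addr0.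
rewrite mul1r mulr1 mul1r.
apply: (@third_arith R w) => //.
rewrite (@seg_sum_cat i j n)// ?leq_addr// -(subrK (D j.+1 n x) (D j n x)) addrA.
rewrite (le_trans (ler_normD _ _))// lerD2r (le_trans (ler_normD _ _))//.
apply: le_trans (lerD h1 (seg_sum_tail j n x)) _.
by move: cw; lra.
Qed.

(** The constant solves K = 3 + (1/8) * 4 * (33 + K). If no threshold is passed, the cube is at most
    3 w times the square; otherwise the restarted tail enters through the induction on its length,
    with total weight 1/8. *)
Lemma third_moment a : (forall i, (a <= i <= n)%N ->
    E (fun x => D i n x ^+ 2) <= w ^+ 2) ->
  forall i, (a <= i)%N -> E (fun x => `|D i n x| ^+ 3) <= 39 * w ^+ 3.
Proof.
move=> hV i; have w3 : 0 < w ^+ 3 by rewrite exprn_gt0.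
move: {2}(n - i)%N (leqnn (n - i)) => m; elim: m i => [|m IH] i him ai.
  have ni : (n <= i)%N by rewrite -subn_eq0 -leqn0.
  rewrite (_ : (fun x => _) = fun=> 0); first by rewrite Ex_cst; nra.
  by apply/funext => x; rewrite seg_sum_nil// normr0 expr0n.
have [ni|ni] := leqP n i.
  rewrite (_ : (fun x => _) = fun=> 0); first by rewrite Ex_cst; nra.
  by apply/funext => x; rewrite seg_sum_nil// normr0 expr0n.
(* One more than the number of terms, so that surviving [K] tests includes the test of the full
   sum. *)
set K := (n - i).+1.
have hk (k : 'I_K) : (i + k <= n)%N.
  by have := ltn_ord k; rewrite ltnS; rewrite -{2}(subnKC (ltnW ni)) leq_add2l.
have p1 : 8 * w ^+ 2 * (\sum_(k < K) E (stop i k)) <= w ^+ 2.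
  apply: le_trans (hV i _); last by rewrite ai ltnW.
  rewrite mulr_sumr (@le_trans _ _ (\sum_(k < K)
    E (fun x => stop i k x * D i n x ^+ 2)))//.
    by apply: ler_sum => k _; exact: kolmogorov.
  rewrite -Ex_sum_bm; last by move=> k _; bm_tac.
  apply: le_Ex; [|int_tac|].
    by apply: bm_int; apply: bm_sum => k _; bm_tac.
  move=> x; rewrite -mulr_suml stop_sum.
  by have [->|->] := alive01 i K x; rewrite ?subr0 ?subrr ?mul1r ?mul0r ?sqr_ge0.
set p := \sum_(k < K) E (stop i k) in p1.
have p0 : 0 <= p by apply: sumr_ge0 => k _; apply: Ex_ge0.
have p8 : 8 * p <= 1.
  have w2 : 0 < w ^+ 2 by rewrite exprn_gt0.
  by rewrite -(ler_pM2r w2) mul1r (le_trans _ p1)//; lra.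
apply: (@le_trans _ _ (3 * w * E (fun x => D i n x ^+ 2) +
    \sum_(k < K) E (fun x => stop i k x * `|D i n x| ^+ 3))).
  rewrite -Ex_sum_bm; last by move=> k _; bm_tac.
  rewrite -ExZ; last by int_tac.
  rewrite -ExD; [|int_tac|]; last first.
    by apply: bm_int; apply: bm_sum => k _; bm_tac.
  apply: le_Ex; [int_tac| |].
    by apply: bm_int; apply: bmD; [bm_tac|apply: bm_sum => k _; bm_tac].
  move=> x; rewrite -mulr_suml stop_sum.
  have := alive01 i (n - i).+1 x; rewrite -/K => -[->|a1].
    by rewrite subr0 mul1r lerDr mulr_ge0 ?sqr_ge0// mulr_ge0// ltW.
  rewrite a1 subrr mul0r addr0.
  have : `|D i n x| <= 3 * w.
    move: a1 => /=; have [->|->] := alive01 i (n - i) x.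
      by rewrite mul0r => /esym/eqP; rewrite oner_eq0.
    rewrite mul1r /hit subnKC 1?ltnW//; case: ifP => //.
    by rewrite subrr => _ /esym/eqP; rewrite oner_eq0.
  by move=> h; rewrite exprS real_normK ?num_real// ler_wpM2r ?sqr_ge0.
apply: (@le_trans _ _ (3 * w * w ^+ 2 + p * (4 * (33 * w ^+ 3 + 39 * w ^+ 3)))).
  apply: lerD.
    rewrite ler_wpM2l//; first by move: w0; lra.
    by apply: hV; rewrite ai ltnW.
  rewrite /p mulr_suml; apply: ler_sum => k _; apply: third_step => //.
  apply: IH; last by rewrite (leq_trans ai)// leqW// leq_addr.
  by move: him ni; clear; lia.
have -> : 3 * w * w ^+ 2 = 3 * w ^+ 3 by ring.
nra.
Qed.

End third_moment.

(** * Variances of segment sums and covariance across a cut *)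

Let normYY i j x : `|Y i x * Y j x| <= c ^+ 2.
Proof. by rewrite normrM expr2 ler_pM. Qed.

(** [Y i] and [Y i.+1] are the only pair on opposite sides of the cut within the range of
    dependence; every other product splits off a centred independent factor. *)
Lemma cross_eq i n : (i.+1 < n)%N ->
  E (fun x => D 0 i.+1 x * D i.+1 n x) = E (fun x => Y i x * Y i.+1 x).
Proof.
move=> i_n.
rewrite (_ : (fun x => _) = fun x => D 0 i.+1 x * D i.+2 n x +
   (D 0 i x * D i.+1 i.+2 x + Y i x * Y i.+1 x)); last first.
  apply/funext => x; rewrite (@seg_sum_cat i.+1 i.+2 n)// (@seg_sum_cat 0 i i.+1)// !seg_sum1.
  ring.
rewrite ExD; [|int_tac|int_tac]; rewrite ExD; [|int_tac|int_tac].
rewrite (@Ex_indep0 i.+1 (D 0 i.+1)) ?add0r; [|exact: smeas_past|by []|by []].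
by rewrite (@Ex_indep0 i (D 0 i)) ?add0r; [|exact: smeas_past|by []|by []].
Qed.

Lemma cross_le i n : `|E (fun x => D 0 i x * D i n x)| <= c ^+ 2.
Proof.
have [ni|ni] := leqP n i.
  rewrite (_ : (fun x => _) = fun=> 0) ?Ex_cst ?normr0 ?sqr_ge0//.
  by apply/funext => x; rewrite (seg_sum_nil _ ni) mulr0.
case: i ni => [|i] ni.
  rewrite (_ : (fun x => _) = fun=> 0) ?Ex_cst ?normr0 ?sqr_ge0//.
  by apply/funext => x; rewrite (@seg_sum_nil 0 0)// mul0r.
rewrite cross_eq// (le_trans (Ex_norm _))//; first by int_tac.
by rewrite -[leRHS](Ex_cst P); apply: le_Ex; [int_tac|int_tac|move=> x].
Qed.

Lemma var_split i n : (i <= n)%N ->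
  E (fun x => D 0 n x ^+ 2) = E (fun x => D 0 i x ^+ 2) +
    E (fun x => D i n x ^+ 2) + 2 * E (fun x => D 0 i x * D i n x).
Proof.
move=> i_n; rewrite -ExZ; last by int_tac.
rewrite -ExD; [|int_tac|int_tac]; rewrite -ExD; [|int_tac|int_tac].
by congr Ex; apply/funext => x; rewrite (@seg_sum_cat 0 i n)//; ring.
Qed.

(* In the Taylor expansion at the sum up to the cut, only the covariance of the
   two terms adjacent to the cut survives the dependence. *)
Lemma lindeberg_step M g0 g1 g2 a n : taylor3 M g0 g1 g2 -> (a.+2 < n)%N ->
  `|E (fun x => g0 (D 0 n x)) - E (fun x => g0 (D 0 a.+2 x))
    - (E (fun x => D 0 n x ^+ 2) - E (fun x => D 0 a.+2 x ^+ 2)) / 2 *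
      E (fun x => g2 (D 0 a.+2 x))| <=
  M * (E (fun x => `|D a.+2 n x| ^+ 3) / 6 + c * E (fun x => D a.+2 n x ^+ 2)
       + 7 / 2 * c ^+ 3).
Proof.
move=> [taylor_g0 taylor_g1 taylor_g2 lip_g0 lip_g1 lip_g2] an.
have M0 : 0 <= M by have := taylor_g2 0 1; rewrite normr1 mulr1; apply: le_trans.
have c0 := c_ge0.
have Sbm g i : lip g -> bm (fun x => g (D 0 i x)) by move=> lg; exact: bm_comp.
have S0 i := Sbm g0 i lip_g0; have S1 i := Sbm g1 i lip_g1; have S2 i := Sbm g2 i lip_g2.
set k := E (fun x => Y a.+1 x * Y a.+2 x).
have k2 : `|k| <= c ^+ 2.
  rewrite /k (le_trans (Ex_norm _))//; first by int_tac.
  by rewrite -[leRHS](Ex_cst P); apply: le_Ex; [int_tac|int_tac|move=> x].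
rewrite (@var_split a.+2 n) 1?ltnW// cross_eq// -/k.
set V := E (fun x => D 0 a.+2 x ^+ 2); set b2 := E (fun x => D a.+2 n x ^+ 2).
set G := E (fun x => g2 (D 0 a.+2 x)).
set b3 := E (fun x => `|D a.+2 n x| ^+ 3).
set e0 := E (fun x => g0 (D 0 n x)); set e0' := E (fun x => g0 (D 0 a.+2 x)).
pose X1 := E (fun x => g1 (D 0 a.+2 x) * D a.+2 n x).
pose X2 := E (fun x => g2 (D 0 a.+2 x) * D a.+2 n x ^+ 2).
have b20 : 0 <= b2 by apply: Ex_ge0 => x; exact: sqr_ge0.
have h1 : `|e0 - (e0' + (X1 + 2^-1 * X2))| <= M / 6 * b3.
  rewrite -!ExZ; [|int_tac|int_tac].
  rewrite -ExD; [|int_tac|int_tac]; rewrite -ExD; [|int_tac|int_tac].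
  apply: Ex_close_le; [int_tac|int_tac|int_tac|move=> x].
  have := taylor_g0 (D 0 a.+2 x) (D a.+2 n x); rewrite -seg_sum_cat// 1?ltnW//.
  rewrite [leRHS]mulrAC; apply: le_trans; rewrite le_eqVlt; apply/orP; left.
  by apply/eqP; congr (`| _ |); field.
(* Past its first term the group is independent of the sum up to the cut, and centred. *)
have h2 : X1 = E (fun x => g1 (D 0 a.+2 x) * Y a.+2 x).
  rewrite -[RHS]addr0 -(@Ex_indep0 a.+2 (fun x => g1 (D 0 a.+2 x)) a.+3 n)//.
    rewrite -ExD; [|int_tac|int_tac]; congr Ex; apply/funext => x.
    by rewrite (@seg_sum_cat a.+2 a.+3 n)// seg_sum1 mulrDr.
  by apply: smeas_lip => //; exact: smeas_past.
have close2 i j b W : (forall x, `|D 0 i x - D 0 j x| <= b) -> bm W ->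
  `|E (fun x => g2 (D 0 i x) * W x) - E (fun x => g2 (D 0 j x) * W x)| <=
  M * b * E (fun x => `|W x|).
  move=> hb bW; rewrite -ExZ; last by int_tac.
  apply: Ex_close_le; [int_tac|int_tac|int_tac|move=> x].
  rewrite -mulrBl normrM ler_wpM2r//.
  have := taylor_g2 (D 0 j x) (D 0 i x - D 0 j x); rewrite subrKC => /le_trans; apply.
  by rewrite ler_wpM2l.
have close2' i j b : (forall x, `|D 0 i x - D 0 j x| <= b) ->
  `|E (fun x => g2 (D 0 i x)) - E (fun x => g2 (D 0 j x))| <= M * b.
  move=> hb; apply: Ex_close; [int_tac|int_tac|move=> x].
  have := taylor_g2 (D 0 j x) (D 0 i x - D 0 j x); rewrite subrKC => /le_trans; apply.
  by rewrite ler_wpM2l.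
have d1 i x : `|D 0 i x - D 0 i.+1 x| <= c.
  by rewrite distrC (@seg_sum_cat 0 i i.+1)// addrAC subrr add0r seg_sum1.
have d1' i x : `|D 0 i.+1 x - D 0 i x| <= c by rewrite distrC.
have d2 i x : `|D 0 i x - D 0 i.+2 x| <= 2 * c.
  by rewrite (le_trans (ler_distD (D 0 i.+1 x) _ _))// mulrDl mul1r lerD.
(* Expansion at [D 0 a.+1]: the leading term vanishes, since [Y a.+1] is the gap between that sum
   and [Y a.+2]. *)
have h3 : `|X1 - E (fun x => g2 (D 0 a.+1 x) * (Y a.+1 x * Y a.+2 x))| <=
    M * c ^+ 3 / 2.
  have z : E (fun x => g1 (D 0 a.+1 x) * D a.+2 a.+3 x) = 0.
    by apply: (@Ex_indep0 a.+1) => //; apply: smeas_lip => //; exact: smeas_past.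
  rewrite h2 -[X in `|X - _|]subr0 -z -ExB; [|int_tac|int_tac].
  apply: Ex_close; [int_tac|int_tac|move=> x]; rewrite seg_sum1.
  have := taylor_g1 (D 0 a.+1 x) (D a.+1 a.+2 x); rewrite -seg_sum_cat// seg_sum1.
  set u := g1 _; set v := g1 _; set s := g2 _ => h.
  rewrite (_ : _ - _ = (u - v - s * Y a.+1 x) * Y a.+2 x); last by ring.
  rewrite normrM (le_trans (ler_pM _ _ h (Yc _ _)))//.
  have : Y a.+1 x ^+ 2 <= c ^+ 2.
    by rewrite -real_normK ?num_real// lerXn2r// nnegrE.
  move: (Y a.+1 x ^+ 2) => q qc.
  have := ler_wpM2l (mulr_ge0 M0 c0) qc; lra.
(* The product of the two terms at the cut is independent of the argument of [g2] once this is moved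
   back to [D 0 a]. The price is a shift by c, then one by 2 c to return to the cut in the mean. *)
have h4 : `|E (fun x => g2 (D 0 a.+1 x) * (Y a.+1 x * Y a.+2 x)) - k * G| <=
    3 * M * c ^+ 3.
  have z : E (fun x => g2 (D 0 a x) * (Y a.+1 x * Y a.+2 x)) =
      E (fun x => g2 (D 0 a x)) * k.
    apply: (@Ex_indep a) => //; last by bm_tac.
      by apply: smeas_lip => //; exact: smeas_past.
    by apply: smeasM; exact: hF.
  have z1 := close2 a.+1 a c (fun x => Y a.+1 x * Y a.+2 x) (d1' a).
  have z2 := close2' a a.+2 (2 * c) (d2 a).
  have {}z1 : `|E (fun x => g2 (D 0 a.+1 x) * (Y a.+1 x * Y a.+2 x)) -
     E (fun x => g2 (D 0 a x)) * k| <= M * c * c ^+ 2.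
    rewrite -z (le_trans (z1 _))//; first by bm_tac.
    rewrite ler_wpM2l ?mulr_ge0//.
    by rewrite -[leRHS](Ex_cst P); apply: le_Ex; [int_tac|int_tac|move=> x].
  rewrite (le_trans (ler_distD (E (fun x => g2 (D 0 a x)) * k) _ _))//.
  have -> : 3 * M * c ^+ 3 = M * c * c ^+ 2 + M * (2 * c) * c ^+ 2 by ring.
  by rewrite lerD// [k * G]mulrC -mulrBl normrM ler_pM.
(* The same device for the square of the group, with the single gap [Y a.+1]: one shift by c back
   and one forth. *)
have h5 : `|X2 - G * b2| <= 2 * M * c * b2.
  have z : E (fun x => g2 (D 0 a.+1 x) * D a.+2 n x ^+ 2) =
      E (fun x => g2 (D 0 a.+1 x)) * b2.
    apply: (@Ex_indep a.+1) => //; last by bm_tac.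
      by apply: smeas_lip => //; exact: smeas_past.
    by apply: smeasX; exact: smeas_future.
  have z1 := close2 a.+2 a.+1 c (fun x => D a.+2 n x ^+ 2) (d1' _).
  have z2 := close2' a.+1 a.+2 c (d1 _).
  rewrite (le_trans (ler_distD (E (fun x => g2 (D 0 a.+1 x)) * b2) _ _))//.
  have -> : 2 * M * c * b2 = M * c * b2 + M * c * b2 by ring.
  apply: lerD.
    rewrite -z (le_trans (z1 _))//; first by bm_tac.
    rewrite le_eqVlt; apply/orP; left; apply/eqP; congr (_ * Ex _ _).
    by apply/funext => x; rewrite ger0_norm// sqr_ge0.
  by rewrite -mulrBl normrM (ger0_norm b20) ler_wpM2r.
move: h1 h3 h4 h5; rewrite !ler_norml.
move=> /andP[? ?] /andP[? ?] /andP[? ?] /andP[? ?].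
by apply/andP; split; lra.
Qed.

(** * Exchange of the groups for Gaussian increments *)

Hypothesis c0 : 0 < c.
Hypothesis Y01 : forall k x, (k < 2)%N -> Y k x = 0.

Local Notation var n := (E (fun x => D 0 n x ^+ 2)).

Let var0 n : (n <= 2)%N -> var n = 0.
Proof.
move=> n2; rewrite (_ : (fun x => _) = fun=> 0) ?Ex_cst//.
apply/funext => x; rewrite /seg_sum big1_seq ?expr0n//= => k.
by rewrite mem_index_iota => /andP[_ kn]; apply: Y01; exact: leq_trans kn n2.
Qed.

Let sq_suffix i n : (i <= n)%N ->
  E (fun x => D i n x ^+ 2) <= var n - var i + 2 * c ^+ 2.
Proof.
move=> i_n; rewrite (var_split i_n).
by have := cross_le i n; rewrite ler_norml => /andP[]; lra.
Qed.

Let var_step i : var i.+1 <= var i + 3 * c ^+ 2.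
Proof.
rewrite (var_split (leqnSn i)).
have := cross_le i i.+1; rewrite ler_norml => /andP[].
have : E (fun x => D i i.+1 x ^+ 2) <= c ^+ 2.
  rewrite -[leRHS](Ex_cst P); apply: le_Ex; [int_tac|int_tac|move=> x].
  by rewrite seg_sum1 -real_normK ?num_real// lerXn2r ?nnegrE ?c_ge0//.
lra.
Qed.

(* The group removed from the right starts at the last index a such that the
   variance drops by at least 95 c^2. *)
Lemma lindeberg_clt (M : R) G0 G1 G2 n (r : R) : heat_family M G0 G1 G2 -> 0 <= r ->
  `|E (fun x => G0 r (D 0 n x)) - G0 (r + var n) 0| <=
    102 * M * c * var n + 40 * c.
Proof.
move=> [hT ht hl htl].
have c10 : 0 <= 10 * c by rewrite mulr_ge0// ltW.
have c2 : 0 < c ^+ 2 by rewrite exprn_gt0.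
have c3 : 0 < c ^+ 3 by rewrite exprn_gt0.
have M0 : 0 <= M.
  by have := taylor_g2 (hT 0 (lexx 0)) 0 1; rewrite normr1 mulr1; apply: le_trans.
have ve k : 0 <= var k by apply: Ex_ge0 => x; exact: sqr_ge0.
have bS i (s : R) : 0 <= s -> bm (fun x => G0 s (D 0 i x)).
  by move=> s0; apply: bm_comp => //; exact: lip_g0 (hT s s0).
elim/ltn_ind: n r => n IH r r0.
(* A variance below 95 c^2 cannot supply a group. The sum and the Gaussian then have standard
   deviation at most 10 c, and the two Lipschitz bounds cost 10 c and 3 * 10 c; this is paid only
   once. *)
have [vn|vn] := ltP (var n) (95 * c ^+ 2).
  have vn10 : var n <= (10 * c) ^+ 2 by move: vn; lra.
  have h1 : `|E (fun x => G0 r (D 0 n x)) - G0 r 0| <= 10 * c.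
    rewrite -(Ex_cst P (G0 r 0)).
    apply: (@le_trans _ _ (E (fun x => `|D 0 n x|))).
      apply: Ex_close_le; [exact: bm_int (bS _ _ _)|int_tac|int_tac|move=> x].
      by rewrite (le_trans (hl _ _ _ _))// subr0.
    by apply: Ex_norm_le => //; [case: (bm_seg_sum 0 n)|int_tac].
  have h2 := htl r (var n) (10 * c) 0 r0 (ve n) c10 vn10.
  rewrite (le_trans (ler_distD (G0 r 0) _ _))//.
  rewrite [X in _ + X]distrC.
  apply: le_trans (lerD h1 h2) _.
  have : 0 <= M * c * var n by rewrite !mulr_ge0// ltW.
  lra.
have ex0 : exists a, (a < n)%N && (95 * c ^+ 2 <= var n - var a).
  exists 0%N; rewrite (@var0 0)// subr0 vn andbT lt0n; apply/eqP => n0.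
  by move: vn; rewrite n0 var0//; lra.
have ub a : (a < n)%N && (95 * c ^+ 2 <= var n - var a) -> (a <= n)%N.
  by case/andP => /ltnW.
case: (ex_maxnP ex0 ub) => a /andP[an va] amax.
have n3 : (2 < n)%N.
  by rewrite ltnNge; apply/negP => n2; move: vn; rewrite var0//; lra.
have a2 : (2 <= a)%N by apply: amax; rewrite n3 (@var0 2)// subr0.
have after i : (a < i)%N -> (i <= n)%N -> var n - var i <= 95 * c ^+ 2.
  move=> ai; rewrite leq_eqVlt => /predU1P[->|i_n].
    by rewrite subrr; lra.
  rewrite leNgt; apply/negP => /ltW h.
  by have := amax i; rewrite i_n h leqNgt ai => /(_ isT).
(* Maximality of [a] bounds the drop from a + 1 on by 95 c^2, and one more term changes it by at
   most 3 c^2. With 2 c^2 for twice the covariance across a cut, every tail of the group has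
   variance at most 100 c^2. *)
have v98 : var n - var a <= 98 * c ^+ 2.
  by have := after a.+1 (ltnSn a) an; have := var_step a; lra.
have suf i : (a <= i <= n)%N -> E (fun x => D i n x ^+ 2) <= (10 * c) ^+ 2.
  move=> /andP[ai i_n]; have := sq_suffix i_n.
  move: ai; rewrite leq_eqVlt => /predU1P[<-|ai]; first by move: v98; lra.
  by have := after i ai i_n; lra.
have third : E (fun x => `|D a n x| ^+ 3) <= 39 * (10 * c) ^+ 3.
  by apply: (third_moment _ _ suf) => //; rewrite mulr_gt0.
have b2 := suf a; rewrite leqnn (ltnW an) in b2; have {}b2 := b2 isT.
(* The exchanged group becomes elapsed heat time. *)
have := IH a an (r + (var n - var a)).
rewrite -addrA subrK addr_ge0//; last by move: va; lra.
move=> /(_ isT) h1.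
have vge : 0 <= var n - var a by move: va; lra.
have h2 : `|E (fun x => G0 (r + (var n - var a)) (D 0 a x)) -
    (E (fun x => G0 r (D 0 a x)) +
     (var n - var a) / 2 * E (fun x => G2 r (D 0 a x)))| <=
    3 * M * (10 * c) ^+ 3.
  have b0 := bS a r r0.
  have b1 : bm (fun x => G0 (r + (var n - var a)) (D 0 a x)).
    by apply: bS; rewrite addr_ge0.
  have b3 : bm (fun x => G2 r (D 0 a x)).
    by apply: bm_comp => //; exact: lip_g2 (hT r r0).
  rewrite -ExZ; last exact: bm_int.
  rewrite -ExD; [|int_tac|int_tac].
  apply: Ex_close; [int_tac|int_tac|move=> x]; rewrite opprD addrA.
  by apply: ht => //; move: v98; lra.
have := lindeberg_step (a := a.-2) (n := n) (hT r r0).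
have -> : a.-2.+2 = a by move: a2; clear; lia.
move=> /(_ an) h3.
(* 39 * 10^3 / 6 from the third moment, 10^2 from the variance and 7 / 2 add up to less than 6604.
   With 3 * 10^3 from the heat flow, a group costs less than 102 * 95, which its drop in variance
   pays for. *)
have {}h3 := le_trans h3 (_ : _ <= 6604 * (M * c ^+ 3)).
have {h3}h3 : `|E (fun x => G0 r (D 0 n x)) - E (fun x => G0 r (D 0 a x)) -
   (var n - var a) / 2 * E (fun x => G2 r (D 0 a x))| <= 6604 * (M * c ^+ 3).
  apply: h3; rewrite [leRHS]mulrCA ler_wpM2l//.
  have := ler_wpM2l (ltW c0) b2; move: third; lra.
have h4 := ler_wpM2l (mulr_ge0 M0 (ltW c0)) va.
move: h1 h2 h3 h4; rewrite !ler_norml.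
move=> /andP[? ?] /andP[? ?] /andP[? ?] h4.
have : 0 <= M * c ^+ 3 by rewrite mulr_ge0// ltW.
by move=> ?; apply/andP; split; lra.
Qed.

End bounded_one_dependent.

(** * Smoothing of Lipschitz functions *)

Section antiderivative.
Context {R : realType}.
Notation mu := (@lebesgue_measure R).

Definition locally_bounded (s : R -> R) :=
  forall b : R, exists K : R, forall t, `|t| <= b -> `|s t| <= K.

Let ib (x y : R) := mu.-integrable setT (EFin \o (\1_`]x, y]%classic : R -> R)).

Let ibP x y : ib x y.
Proof.
apply/integrableP; split; first by apply/measurable_EFinP; exact: measurable_indic.
under eq_integral do rewrite /= ger0_norm ?indicE//.
rewrite integral_indic// setIT /= lebesgue_measure_itv/=.
by case: ifP; rewrite ?ltry// -EFinB ltry.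
Qed.

Let int_ind x y : x <= y -> \int[mu]_t (\1_`]x, y]%classic t : R) = y - x.
Proof.
move=> xy; rewrite /Rintegral integral_indic// setIT /= lebesgue_measure_itv/=.
rewrite lte_fin; case: ltP => // yx; have -> : y = x by apply/le_anti/andP.
by rewrite subrr.
Qed.

Let isind (s : R -> R) x y : measurable_fun setT s -> locally_bounded s ->
  mu.-integrable setT (EFin \o (fun t => s t * \1_`]x, y]%classic t)).
Proof.
move=> ms bs; have [K hK] := bs (`|x| + `|y|).
apply: (@le_integrable _ _ _ mu setT _ _
  (EFin \o (fun t => `|K| * \1_`]x, y]%classic t))) => //.
- apply/measurable_EFinP; apply: measurable_funM => //; exact: measurable_indic.
- move=> t _; rewrite lee_fin /= !indicE.
  case: (boolP (t \in _)); last by rewrite !mulr0.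
  rewrite inE/= in_itv/= => /andP[xt ty].
  rewrite !mulr1 normr_id (le_trans (hK t _)) ?ler_norm// ler_norml.
  have := ler_norm y; have := ler_norm (- x); rewrite normrN.
  have := normr_ge0 x; have := normr_ge0 y.
  by move=> ? ? ? ?; apply/andP; split; lra.
- rewrite (_ : _ \o _ = (fun t => `|K|%:E * (EFin \o \1_`]x, y]%classic) t)%E).
    by apply: integrableZl => //; exact: ibP.
  by apply/funext.
Qed.

(** Bounds on increments replace a derivative, so that the statement also covers the discontinuous
    sign function integrated in the duality argument. The witness is the integral from 0, with its
    sign reversed to the left of 0. *)
Lemma exists_antiderivative (s : R -> R) :
  measurable_fun setT s -> locally_bounded s ->
  exists H : R -> R, forall x y a b : R, x <= y ->
    (forall t, x < t -> t <= y -> a <= s t <= b) ->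
    a * (y - x) <= H y - H x <= b * (y - x).
Proof.
move=> ms bs.
pose J x y := \int[mu]_t (s t * \1_`]x, y]%classic t).
exists (fun x => J 0 x - J x 0) => x y a b xy hab.
have e : (J 0 y - J y 0) - (J 0 x - J x 0) = J x y.
  rewrite /J.
  rewrite -RintegralB//; [|exact: isind|exact: isind].
  rewrite -[X in _ - X]RintegralB//; [|exact: isind|exact: isind].
  rewrite -RintegralB//=; [|exact: integrableB (isind _ _ _ _) (isind _ _ _ _)..].
  apply: eq_Rintegral => t _; rewrite !indicE.
  have m u v : (t \in `]u, v]%classic) = (u < t) && ~~ (v < t).
    by rewrite -leNgt; apply/idP/idP; rewrite inE/= in_itv/=.
  rewrite !m; have : y < t -> x < t by apply: le_lt_trans.
  case: (0 < t); case: (y < t); case: (x < t) => /= h;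
    first [ring | by have := h isT].
rewrite e -(int_ind xy) -!RintegralZl//; [|exact: ibP|exact: ibP].
have iz k : mu.-integrable setT (EFin \o (fun t => k * \1_`]x, y]%classic t)).
  rewrite (_ : _ \o _ = (fun t => k%:E * (EFin \o \1_`]x, y]%classic) t)%E).
    apply: integrableZl => //; exact: ibP.
  by apply/funext.
have h t : a * \1_`]x, y]%classic t <= s t * \1_`]x, y]%classic t <=
    b * \1_`]x, y]%classic t.
  rewrite !indicE; case: (boolP (t \in _)); last by rewrite !mulr0 lexx.
  by rewrite inE/= in_itv/= => /andP[xt ty]; rewrite !mulr1 hab.
by apply/andP; split; apply: le_Rintegral => //; first [exact: isind|
  move=> t _; have /andP[] := h t].
Qed.
End antiderivative.

(** * Differentiation rules and Taylor remainders *)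

Section derivative_rules.
Context {R : realType}.
Implicit Types (f g : R -> R) (x a b : R).

Lemma is_derive_little_o f x a :
  (forall e, 0 < e -> exists2 r : R, 0 < r & forall b, `|b| < r ->
    `|f (x + b) - f x - a * b| <= e * `|b|) -> is_derive x (1 : R) f a.
Proof.
move=> h.
suff : (fun b => b^-1 *: ((f \o shift x) (b *: (1 : R)) - f x)) @ 0^' --> a.
  by move=> fa; apply: DeriveDef; [apply/cvg_ex; exists a|exact: cvg_lim fa].
apply/cvgrPdist_le => e e0; have [r r0 hr] := h e e0.
near=> b.
have b0 : b != 0 by near: b; exact: nbhs_dnbhs_neq.
have br : `|b| < r.
  near: b; apply: dnbhs0_lt => //.
rewrite /= /GRing.scale/= mulr1 [b + x]addrC.
rewrite (_ : a - _ = - ((f (x + b) - f x - a * b) / b)); last by field.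
by rewrite normrN normrM normfV ler_pdivrMr ?normr_gt0//; exact: hr.
Unshelve. all: by end_near. Qed.

Lemma der_continuous f x a : is_derive x (1 : R) f a -> {for x, continuous f}.
Proof.
by move=> [df _]; apply: differentiable_continuous; exact/derivable1_diffP.
Qed.

Lemma der_cst k x : is_derive x (1 : R) (fun=> k : R) 0.
Proof. exact: is_derive_cst. Qed.

Lemma der_id x : is_derive x (1 : R) (fun t : R => t) 1.
Proof. exact: is_derive_id. Qed.

Lemma derD f g x a b : is_derive x (1 : R) f a -> is_derive x (1 : R) g b ->
  is_derive x (1 : R) (fun t => f t + g t) (a + b).
Proof. exact: is_deriveD. Qed.

Lemma derN f x a : is_derive x (1 : R) f a ->
  is_derive x (1 : R) (fun t => - f t) (- a).
Proof. exact: is_deriveN. Qed.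

Lemma derM f g x a b : is_derive x (1 : R) f a -> is_derive x (1 : R) g b ->
  is_derive x (1 : R) (fun t => f t * g t) (a * g x + f x * b).
Proof.
move=> fa gb; apply: is_derive_eq (is_deriveM fa gb) _.
by rewrite /GRing.scale/= addrC [a * _]mulrC.
Qed.

Lemma derZ f x k a : is_derive x (1 : R) f a ->
  is_derive x (1 : R) (fun t => k * f t) (k * a).
Proof. exact: is_deriveZ. Qed.

Lemma der_comp f g x a b : is_derive (g x) (1 : R) f a ->
  is_derive x (1 : R) g b -> is_derive x (1 : R) (fun t => f (g t)) (a * b).
Proof. exact: is_derive1_comp. Qed.

Lemma der_affine f x k l a : is_derive (k + x * l) (1 : R) f a ->
  is_derive x (1 : R) (fun t => f (k + t * l)) (a * l).
Proof.
move=> fa; apply: der_comp => //.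
apply: is_derive_eq (derD (der_cst k x) (derM (der_id x) (der_cst l x))) _.
by rewrite add0r mul1r mulr0 addr0.
Qed.

Lemma der_shift f x k a : is_derive (x + k) (1 : R) f a ->
  is_derive x (1 : R) (fun t => f (t + k)) a.
Proof.
move=> fa; rewrite -(mulr1 a); apply: der_comp => //.
by apply: is_derive_eq (derD (der_id x) (der_cst k x)) _; rewrite addr0.
Qed.

Lemma der_mean f df a b : a <= b ->
  (forall x, is_derive x (1 : R) f (df x)) ->
  exists2 x, a <= x <= b & f b - f a = df x * (b - a).
Proof.
move=> ab fd; have [|x xab ->] := MVT_segment ab (fun x _ => fd x).
  by apply: continuous_subspaceT => x; exact: der_continuous (fd x).
by exists x; rewrite -?in_itv.
Qed.

(** Mean value theorem for g + f and g - f. Taking for g a power of t times the expected remainder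
    gives Taylor bounds with the right factorials and no integral. *)
Lemma der_dominated f df g dg :
  (forall x, is_derive x (1 : R) f (df x)) ->
  (forall x, is_derive x (1 : R) g (dg x)) ->
  (forall x, 0 <= x <= 1 -> `|df x| <= dg x) ->
  `|f 1 - f 0| <= g 1 - g 0.
Proof.
move=> fd gd h; rewrite ler_norml; apply/andP; split.
  have [x x01] := der_mean ler01 (fun x => derD (gd x) (fd x)).
  by have := h x x01; rewrite ler_norml subr0 => /andP[]; lra.
have [x x01] := der_mean ler01 (fun x => derD (gd x) (derN (fd x))).
by have := h x x01; rewrite ler_norml subr0 => /andP[]; lra.
Qed.

Section taylor.
Variables (M : R) (f f1 f2 : R -> R).
Hypothesis ff1 : forall x, is_derive x (1 : R) f (f1 x).
Hypothesis f1f2 : forall x, is_derive x (1 : R) f1 (f2 x).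
Hypothesis f2M : forall x b, `|f2 (x + b) - f2 x| <= M * `|b|.

Lemma taylor_first x b : `|f1 (x + b) - f1 x - f2 x * b| <= M * b ^+ 2 / 2.
Proof.
have d1 t : is_derive t (1 : R) (fun t => f1 (x + t * b) - t * (f2 x * b))
    (f2 (x + t * b) * b - f2 x * b).
  apply: is_derive_eq (derD (der_affine (f1f2 _))
    (derN (derM (der_id t) (der_cst (f2 x * b) t)))) _.
  by rewrite mul1r mulr0 addr0.
have d2 t : is_derive t (1 : R) (fun t => M * b ^+ 2 / 2 * (t * t))
    (M * b ^+ 2 * t).
  apply: is_derive_eq (derZ _ (derM (der_id t) (der_id t))) _.
  by field.
have := der_dominated d1 d2; rewrite !mul1r !mul0r !addr0 subr0 mulr0 subr0 mulr1.
move=> h; rewrite (le_trans _ (h _))//.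
  by rewrite le_eqVlt; apply/orP; left; apply/eqP; congr (`| _ |); ring.
move=> t /andP[t0 _]; rewrite -mulrBl normrM.
apply: le_trans (ler_wpM2r (normr_ge0 _) (f2M _ _)) _.
rewrite normrM (ger0_norm t0) -(real_normK (num_real b)).
by rewrite le_eqVlt; apply/orP; left; apply/eqP; ring.
Qed.

Lemma taylor_second x b :
  `|f (x + b) - f x - f1 x * b - f2 x * b ^+ 2 / 2| <= M * `|b| ^+ 3 / 6.
Proof.
have d1 t : is_derive t (1 : R)
    (fun t => f (x + t * b) - (t * (f1 x * b) + f2 x * b ^+ 2 / 2 * (t * t)))
    (f1 (x + t * b) * b - (f1 x * b + f2 x * b ^+ 2 * t)).
  apply: is_derive_eq (derD (der_affine (ff1 _))
    (derN (derD (derM (der_id t) (der_cst (f1 x * b) t))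
      (derZ _ (derM (der_id t) (der_id t)))))) _.
  by field.
have d2 t : is_derive t (1 : R) (fun t => M * `|b| ^+ 3 / 6 * (t * (t * t)))
    (M * `|b| ^+ 3 / 2 * (t * t)).
  apply: is_derive_eq (derZ _ (derM (der_id t) (derM (der_id t) (der_id t)))) _.
  by field.
have := der_dominated d1 d2; rewrite !mul1r !mul0r !mulr0 !addr0 !subr0 !mulr1.
move=> h; rewrite (le_trans _ (h _))//.
  by rewrite le_eqVlt; apply/orP; left; apply/eqP; congr (`| _ |); ring.
move=> t /andP[t0 _].
rewrite (_ : _ - _ = (f1 (x + t * b) - f1 x - f2 x * (t * b)) * b); last by ring.
rewrite normrM (le_trans (ler_wpM2r (normr_ge0 _) (taylor_first _ _)))//.
rewrite exprMn -(real_normK (num_real b)).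
by rewrite le_eqVlt; apply/orP; left; apply/eqP; field.
Qed.

End taylor.

End derivative_rules.

Section smoothing.
Context {R : realType}.

Record smooth_test (M B : R) (f f1 f2 : R -> R) := SmoothTest {
  sm_f1 : forall x, is_derive x (1 : R) f (f1 x);
  sm_f2 : forall x, is_derive x (1 : R) f1 (f2 x);
  sm_f2_lip : forall x b, `|f2 (x + b) - f2 x| <= M * `|b|;
  sm_f1_le : forall x, `|f1 x| <= 1;
  sm_f2_le : forall x, `|f2 x| <= B }.

Lemma continuous_locally_bounded (s : R -> R) :
  continuous s -> locally_bounded s.
Proof.
move=> cs b; have [b0|b0] := ltP b 0.
  by exists 0 => t /le_lt_trans/(_ b0); rewrite ltNge normr_ge0.
have nb : - b <= b by lra.
have [|x _ hx] := @EVT_max R (fun t => `|s t|) (- b) b nb.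
  apply: continuous_subspaceT => t.
  exact: (continuous_comp (cs t) (@norm_continuous _ _ _)).
by exists `|s x| => t tb; apply: hx; rewrite in_itv/= -ler_norml.
Qed.

Lemma exists_primitive (s : R -> R) : continuous s ->
  exists H : R -> R, (forall x, is_derive x (1 : R) H (s x)) /\
    forall x y a b : R, x <= y ->
    (forall t, x < t -> t <= y -> a <= s t <= b) ->
    a * (y - x) <= H y - H x <= b * (y - x).
Proof.
move=> cs.
have [|H hH] := @exists_antiderivative R s _ (continuous_locally_bounded cs).
  exact: continuous_measurable_fun.
exists H; split => // x; apply: is_derive_little_o => e e0.
have /cvgrPdist_le/(_ e e0) := cs x; rewrite -nbhs_nearE => -[r /= r0 hr].
exists r => // b br.
have near_s t : `|t - x| <= `|b| -> s x - e <= s t <= s x + e.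
  move=> tb; have : `|s x - s t| <= e.
    by apply: hr => /=; rewrite distrC; exact: le_lt_trans br.
  by rewrite ler_norml => /andP[? ?]; apply/andP; split; lra.
have [b0|b0] := leP 0 b.
  have /andP[] : (s x - e) * (x + b - x) <= H (x + b) - H x
      <= (s x + e) * (x + b - x).
    apply: hH => [|t xt tx]; first by lra.
    by apply: near_s; rewrite (ger0_norm b0) ger0_norm; lra.
  rewrite (ger0_norm b0) addrAC subrr add0r => ? ?.
  by rewrite ler_norml; apply/andP; split; lra.
have /andP[] : (s x - e) * (x - (x + b)) <= H x - H (x + b)
    <= (s x + e) * (x - (x + b)).
  apply: hH => [|t xt tx]; first by lra.
  by apply: near_s; rewrite (ltr0_norm b0) ler0_norm; lra.
rewrite (ltr0_norm b0) opprD addrA subrr add0r => ? ?.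
by rewrite ler_norml; apply/andP; split; lra.
Qed.

(* Two successive averages of [h] over windows of length [e], written as second
   differences of a second primitive. *)
Lemma smoothing (h : R -> R) (e : R) : 0 < e ->
  (forall x y, `|h x - h y| <= `|x - y|) ->
  exists f f1 f2, smooth_test (4 / e ^+ 2) (2 / e) f f1 f2 /\
    forall x, `|f x - h x| <= e.
Proof.
move=> e0 hl.
have ch : continuous h.
  by apply: (@lip_continuous R h 1) => x y; rewrite mul1r.
have [H [dH bH]] := exists_primitive ch.
have [HH [dHH _]] := exists_primitive (fun x => der_continuous (dH x)).
have e2 : 0 < e ^+ 2 by rewrite exprn_gt0.
(* Applied to [HH], [H] and [h], this one operator gives the smoothed function and its first two
   derivatives. Its coefficients 1, -2, 1 over e^2 account for the constant 4 / e^2. *)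
pose D2 (g : R -> R) x := (e ^+ 2)^-1 * (g (x + e) + (-2) * g x + g (x + - e)).
have dD2 g dg x : (forall x, is_derive x (1 : R) g (dg x)) ->
    is_derive x (1 : R) (D2 g) (D2 dg x).
  move=> gd; exact: (derZ _ (derD (derD (der_shift (gd _)) (derZ _ (gd _)))
    (der_shift (gd _)))).
have mD2 g dg x : (forall x, is_derive x (1 : R) g (dg x)) ->
    exists2 t, 0 <= t <= e & D2 g x = e^-1 * (dg (t + x) - dg (t + (x - e))).
  move=> gd.
  have [t te] := der_mean (ltW e0) (fun t => derD (der_shift (gd (t + x)))
    (derN (der_shift (gd (t + (x - e)))))).
  rewrite !add0r subr0 => hh; exists t => //.
  have ee : dg (t + x) + - dg (t + (x - e)) = (g (e + x) + - g (e + (x - e)) -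
      (g x + - g (x - e))) / e by rewrite hh mulfK// gt_eqF.
  rewrite ee /D2 [e + x]addrC (_ : e + (x - e) = x); last by ring.
  by field; rewrite gt_eqF.
have hd t : `|h (t + e) - h t| <= e.
  by rewrite (le_trans (hl _ _))// addrAC subrr add0r gtr0_norm.
exists (D2 HH), (D2 H), (D2 h); split; last first.
  move=> x; have [t /andP[t0 te] ->] := mD2 _ _ x dHH.
  have /andP[] : (h x - e) * (t + x - (t + (x - e))) <=
      H (t + x) - H (t + (x - e)) <= (h x + e) * (t + x - (t + (x - e))).
    apply: bH => [|u u1 u2]; first by lra.
    have := hl u x; rewrite ler_norml => /andP[? ?].
    have : `|u - x| <= e by rewrite ler_norml; apply/andP; split; lra.
    by move=> ?; apply/andP; split; lra.
  rewrite (_ : t + x - _ = e); last by ring.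
  set q := H _ - H _; have -> : q = (e^-1 * q) * e by field; rewrite gt_eqF.
  rewrite [e^-1 * (_ * e)]mulrC mulfK ?gt_eqF// !(ler_pM2r e0) => h1 h2.
  by rewrite ler_norml; apply/andP; split; lra.
split.
- by move=> x; exact: dD2.
- move=> x; rewrite /D2; apply: (dD2 H h) => //.
- move=> x b; rewrite /D2 -mulrBr normrM gtr0_norm ?invr_gt0//.
  rewrite [4 / _]mulrC -mulrA ler_wpM2l ?invr_ge0 ?(ltW e2)//.
  have := hl (x + b + e) (x + e); have := hl (x + b) x.
  have := hl (x + b + - e) (x + - e).
  rewrite (_ : x + b + e - (x + e) = b); last by ring.
  rewrite (_ : x + b + - e - (x + - e) = b); last by ring.
  rewrite (_ : x + b - x = b); last by ring.
  rewrite !ler_norml => /andP[? ?] /andP[? ?] /andP[? ?].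
  by apply/andP; split; lra.
- move=> x; have [t _ ->] := mD2 _ _ x dH.
  rewrite normrM gtr0_norm ?invr_gt0// mulrC ler_pdivrMr// mul1r.
  have := hd (t + (x - e)); rewrite (_ : t + (x - e) + e = t + x)//; ring.
- move=> x; rewrite /D2 normrM gtr0_norm ?invr_gt0//.
  rewrite mulrC ler_pdivrMr//.
  rewrite (_ : 2 / e * e ^+ 2 = e + e); last by field; rewrite gt_eqF.
  have := hd x; have := hd (x - e); rewrite subrK !ler_norml.
  by move=> /andP[? ?] /andP[? ?]; apply/andP; split; lra.
Qed.

End smoothing.

(** * The standard normal distribution *)

Section gaussian.
Context {R : realType}.
Notation mu := (@lebesgue_measure R).
Local Notation p := (normal_pdf (0 : R) 1).

Definition stdnormal : probability (measurableTypeR R) R := normal_prob 0 1.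
Local Notation E := (Ex stdnormal).

Let dom : stdnormal `<< mu.
Proof. exact: normal_prob_dominates. Qed.

Let mp : measurable_fun setT (EFin \o p).
Proof. by apply/measurable_EFinP; exact: measurable_normal_pdf. Qed.

Lemma ge0_integral_stdnormal (f : R -> \bar R) : measurable_fun setT f ->
  (forall x, 0 <= f x)%E ->
  (\int[stdnormal]_x f x = \int[mu]_x (f x * (p x)%:E))%E.
Proof.
move=> mf f0.
rewrite -(Radon_Nikodym_SigmaFinite.change_of_variables dom)//.
have mRN := Radon_Nikodym_SigmaFinite.f_integrable dom.
apply: ae_eq_integral => //.
- by apply: emeasurable_funM => //; exact: measurable_int mRN.
- exact: emeasurable_funM.
- apply: ae_eqe_mul2l; apply: integral_ae_eq => //.
  by move=> A _ mA; rewrite -Radon_Nikodym_SigmaFinite.f_integral.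
Qed.

Lemma integral_stdnormal (g : R -> R) : intble stdnormal g ->
  mu.-integrable setT (EFin \o (fun x => g x * p x)) /\
  E g = \int[mu]_x (g x * p x).
Proof.
move=> ig; have mg := intble_meas ig.
have ip : mu.-integrable setT (EFin \o (fun x => g x * p x)).
  apply/integrableP; split.
    by apply/measurable_EFinP; apply: measurable_funM => //; exact/measurable_EFinP.
  move/integrableP : ig => [_]; rewrite ge0_integral_stdnormal//; last first.
    by apply: measurableT_comp => //; exact/measurable_EFinP.
  apply: le_lt_trans; rewrite le_eqVlt; apply/orP; left; apply/eqP.
  apply: eq_integral => x _ /=.
  by rewrite normrM EFinM (ger0_norm (normal_pdf_ge0 _ _ _)).
split => //; rewrite /Ex /Rintegral; congr fine.
rewrite -(Radon_Nikodym_change_of_variables dom)//.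
apply: ae_eq_integral => //.
- apply: emeasurable_funM; first exact/measurable_EFinP.
  apply: measurable_int; exact: Radon_Nikodym_integrable.
- exact: measurable_int ip.
rewrite [X in ae_eq _ _ _ X](_ : _ =
  (fun x => (EFin \o g) x * (EFin \o p) x)%E); last first.
  by apply/funext => x /=; rewrite EFinM.
apply: ae_eqe_mul2l; apply: integral_ae_eq => //.
  exact: Radon_Nikodym_integrable.
by move=> A _ mA; rewrite -Radon_Nikodym_integral.
Qed.

Lemma stdnormal_pdfE x : p x = (Num.sqrt (pi *+ 2))^-1 * expR (- (x ^+ 2 / 2)).
Proof.
rewrite normal_pdfE ?oner_eq0// /normal_peak /normal_fun expr1n mul1r subr0.
by rewrite mulNr.
Qed.

(** A crude bound by comparison with the normal density of variance 2: y exp(-y) <= 1 at y = x^2 / 4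
    gives x^2 exp(-x^2/2) <= 4 exp(-x^2/4), and 4 <= 9 / sqrt 2. The 9 is a square chosen to give
    E|Z| <= 3. *)
Lemma stdnormal_sqr : intble stdnormal (fun z => z ^+ 2) /\
  E (fun z => z ^+ 2) <= 9.
Proof.
pose s : R := Num.sqrt 2.
have s0 : 0 < s by rewrite sqrtr_gt0.
have s2 : s ^+ 2 = 2 by rewrite sqr_sqrtr.
have m2 : measurable_fun setT (fun z : R => z ^+ 2).
  by apply: measurable_funX.
have le2 : (\int[stdnormal]_z (z ^+ 2)%:E <= 9%:E)%E.
  rewrite ge0_integral_stdnormal//; [|exact/measurable_EFinP|]; last first.
    by move=> x; rewrite lee_fin sqr_ge0.
  have -> : 9%:E = (\int[mu]_x (9%:E * (normal_pdf 0 s x)%:E))%E.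
    rewrite integralZl//; last exact: integrable_normal_pdf.
    by rewrite integral_normal_pdf mule1.
  apply: ge0_le_integral => //.
  - by move=> x _; rewrite mule_ge0// lee_fin ?sqr_ge0// normal_pdf_ge0.
  - by apply: emeasurable_funM => //; exact/measurable_EFinP.
  - apply: emeasurable_funM => //; apply/measurable_EFinP.
    exact: measurable_normal_pdf.
  move=> x _; rewrite -!EFinM lee_fin stdnormal_pdfE normal_pdfE ?gt_eqF//.
  rewrite /normal_peak /normal_fun subr0 s2.
  have -> : 2 * pi *+ 2 = 2 * (pi *+ 2) :> R by ring.
  rewrite sqrtrM// -/s invfM.
  have -> : - x ^+ 2 / (2 *+ 2) = - (x ^+ 2 / 4) by field.
  have -> : - (x ^+ 2 / 2) = - (x ^+ 2 / 4) - (x ^+ 2 / 4) by field.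
  rewrite expRD; set a := expR _; set q := (Num.sqrt _)^-1.
  have a0 : 0 < a by exact: expR_gt0.
  have q0 : 0 <= q by rewrite invr_ge0.
  have xa : x ^+ 2 / 4 * a <= 1.
    rewrite /a expRN ler_pdivrMr ?expR_gt0// mul1r.
    by have := expR_ge1Dx (x ^+ 2 / 4); lra.
  have h4 : 4 <= 9 / s.
    rewrite ler_pdivlMr//; have : s <= 2 by rewrite -(ler_pXn2r (n := 2)) ?nnegrE ?(ltW s0)// s2; lra.
    lra.
  have h : x ^+ 2 * (a * a) <= 9 / s * a.
    apply: (@le_trans _ _ (4 * a)); last by rewrite ler_wpM2r// ltW.
    rewrite mulrA ler_pM2r//; lra.
  have := ler_wpM2l q0 h.
  move=> hq; apply: le_trans (le_trans hq _).
    by rewrite le_eqVlt; apply/orP; left; apply/eqP; ring.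
  by rewrite le_eqVlt; apply/orP; left; apply/eqP; ring.
split.
  apply/integrableP; split; first exact/measurable_EFinP.
  under eq_integral do rewrite /= ger0_norm ?sqr_ge0//.
  by rewrite (le_lt_trans le2)// ltry.
rewrite -lee_fin /Ex /Rintegral fineK// ge0_fin_numE ?(le_lt_trans le2) ?ltry//.
by apply: integral_ge0 => x _; rewrite lee_fin sqr_ge0.
Qed.

End gaussian.

(** * Stein's identity *)

Section stein.
Context {R : realType}.
Notation mu := (@lebesgue_measure R).
Local Notation p := (normal_pdf (0 : R) 1).
Local Notation E := (Ex (@stdnormal R)).

Let der_p x : is_derive x (1 : R) p (- x * p x).
Proof.
rewrite stdnormal_pdfE (_ : p = fun x => (Num.sqrt (pi *+ 2))^-1 * expR (- (2^-1 * (x * x)))).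
  apply: is_derive_eq (derZ _ (der_comp (is_derive_expR _)
    (derN (derZ _ (derM (der_id x) (der_id x)))))) _.
  rewrite (_ : 2^-1 * (x * x) = x ^+ 2 / 2); last by field.
  set a := expR _; set k := _^-1; move: a k => a k. by field.
by apply/funext => y; rewrite stdnormal_pdfE; congr (_ * expR _); ring.
Qed.

Lemma stdnormal_id : intble (@stdnormal R) id.
Proof. by apply: intble_sqr => //; exact: stdnormal_sqr.1. Qed.

(** Since p' = - x p, the product f p is a primitive of (f' - x f) p. Its boundary values on growing
    intervals tend to 0, and dominated convergence identifies the limit with the integral over the
    line. *)
Lemma stein_identity (f f' : R -> R) (A B : R) :
  (forall x, is_derive x (1 : R) f (f' x)) -> continuous f' ->
  (forall x, `|f x| <= A) -> (forall x, `|f' x| <= B) ->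
  E (fun z => f z * z) = E f'.
Proof.
move=> ff' cf' fA f'B.
have cf : continuous f by move=> x; exact: der_continuous (ff' x).
have A0 : 0 <= A by exact: le_trans (fA 0).
have if' : intble (@stdnormal R) f'.
  by apply: bm_int; split; [exact: continuous_measurable_fun|exists B].
have ifz : intble (@stdnormal R) (fun z => f z * z).
  apply: (@le_intble _ (measurableTypeR R) R (@stdnormal R) (fun z => f z * z) (fun z => A * `|z|)).
  - by apply: measurable_funM => //; exact: continuous_measurable_fun.
  - by apply: intbleZ; apply: intble_norm; exact: stdnormal_id.
  - by move=> x; rewrite normrM ler_wpM2r.
apply/esym/eqP; rewrite -subr_eq0 -ExB//; apply/eqP.
have ig := intbleB if' ifz; have [ip ->] := integral_stdnormal ig.
pose g x := (f' x - f x * x) * p x.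
have cp : continuous p by exact: continuous_normal_pdf.
have cg : continuous g.
  move=> x; apply: cvgM; last exact: cp.
  by apply: cvgB; [exact: cf'|apply: cvgM; [exact: cf|exact: cvg_id]].
have dg x : is_derive x (1 : R) (fun x => f x * p x) (g x).
  by apply: is_derive_eq (derM (ff' x) (der_p x)) _; rewrite /g; ring.
pose k : R := (Num.sqrt (pi *+ 2))^-1.
have k0 : 0 <= k by rewrite invr_ge0.
pose I (n : nat) : set R := [set` `[- n.+1%:R, n.+1%:R]%R].
have uE n : (\int[mu]_(x in I n) (g x)%:E)%E =
    (f n.+1%:R * p n.+1%:R - f (- n.+1%:R) * p (- n.+1%:R))%:E.
  rewrite /I (@continuous_FTC2 R g (fun x => f x * p x)) ?EFinB//.
  - by rewrite gtrN// ltr0n.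
  - by apply: continuous_subspaceT.
  - split.
    + by move=> x _; have [] := dg x.
    + by apply: cvg_at_right_filter; exact: der_continuous (dg _).
    + by apply: cvg_at_left_filter; exact: der_continuous (dg _).
  - by move=> x _; rewrite derive1E; exact: (@derive_val _ _ _ _ _ _ _ (dg x)).
(* From exp(m^2 / 2) >= 1 + m^2 / 2 >= m / 2, a decay of order 1 / m, enough for bounded f. *)
have fp n (e : R) : e ^+ 2 = n.+1%:R ^+ 2 -> `|f e * p e| <= 2 * A * k / n.+1%:R.
  move=> e2; rewrite normrM (ger0_norm (normal_pdf_ge0 _ _ _)) stdnormal_pdfE e2 -/k.
  have -> : 2 * A * k / n.+1%:R = A * (k * (2 / n.+1%:R)) by ring.
  apply: ler_pM => //; first by rewrite mulr_ge0// expR_ge0.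
  rewrite ler_wpM2l// expRN.
  have n0 : 0 < n.+1%:R :> R by rewrite ltr0n.
  have n1 : 1 <= n.+1%:R :> R by rewrite ler1n.
  rewrite -[leRHS]invf_div lef_pV2 ?posrE ?expR_gt0 ?divr_gt0//.
  apply: le_trans (expR_ge1Dx _).
  by set m := n.+1%:R in n0 n1 *; nra.
have lim0 : (\int[mu]_(x in I n) (g x)%:E)%E @[n --> \oo]
    --> 0%:E.
  under eq_fun do rewrite uE.
  apply: cvg_EFin; first exact: nearW.
  apply/cvgrPdist_le => e e0; near=> n.
  rewrite sub0r normrN /=.
  apply: (@le_trans _ _ (4 * A * k / n.+1%:R)).
    apply: le_trans (ler_normB _ _) _.
    apply: le_trans (lerD (fp n _ erefl) (fp n _ (sqrrN _))) _.
    by rewrite -mulrDl ler_wpM2r ?invr_ge0// le_eqVlt; apply/orP; left; apply/eqP; ring.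
  rewrite ler_pdivrMr ?ltr0n// -ler_pdivrMl//.
  apply: (@le_trans _ _ n%:R); last by rewrite ler_nat.
  near: n; exact: nbhs_infty_ger.
have lim1 : (\int[mu]_(x in I n) (g x)%:E)%E @[n --> \oo]
    --> (\int[mu]_x (g x)%:E)%E.
  under eq_fun do rewrite integral_mkcond.
  apply: (@dominated_cvg _ _ _ mu setT _ _ _ (fun x => `|(g x)%:E|)%E) => //.
  - move=> n; apply/(measurable_restrictT _ _).1; first exact: measurable_itv.
    by apply/measurable_EFinP/measurable_funTS; exact: continuous_measurable_fun.
  - move=> x _; apply: cvg_near_cst; near=> n.
    rewrite patchE mem_set// /I /= in_itv/= -ler_norml.
    apply: (@le_trans _ _ n%:R); last by rewrite ler_nat.
    near: n; exact: nbhs_infty_ger.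
  - exact: integrable_abse ip.
  - by move=> n x _; rewrite patchE; case: ifP => // _; rewrite abse0.
by rewrite /Rintegral -(cvg_unique _ lim0 lim1).
Unshelve. all: by end_near.
Qed.

End stein.

(** * The heat flow of a smooth test function *)

Section heat.
Context {R : realType}.
Local Notation E := (Ex (@stdnormal R)).

Lemma lip_of_der (f df : R -> R) (L : R) :
  (forall x, is_derive x (1 : R) f (df x)) -> (forall x, `|df x| <= L) ->
  forall x y, `|f x - f y| <= L * `|x - y|.
Proof.
move=> fd hL.
have h x y : x <= y -> `|f y - f x| <= L * `|y - x|.
  by move=> xy; have [t _ ->] := der_mean xy fd; rewrite normrM ler_wpM2r.
move=> x y; have [xy|/ltW yx] := leP x y; last exact: h.
by rewrite distrC [`|x - y|]distrC; exact: h.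
Qed.

Lemma intble_lip (f : R -> R) (s x : R) : lip f ->
  intble (@stdnormal R) (fun z => f (x + s * z)).
Proof.
move=> lf; apply: (@intble_comp R _ (measurableTypeR R) _ f (fun z => x + s * z) lf).
apply: intbleD; first exact: bm_int (bm_cst _).
by apply: intbleZ; exact: stdnormal_id.
Qed.

Definition heat (f : R -> R) (r x : R) : R := E (fun z => f (x + Num.sqrt r * z)).

Let abs1 : E (fun z => `|z|) <= 3.
Proof.
apply: Ex_norm_le => //; first exact: stdnormal_sqr.1.
by rewrite (le_trans stdnormal_sqr.2)//; lra.
Qed.

Let iabs : intble (@stdnormal R) (fun z => `|z|).
Proof. by apply: intble_norm; exact: stdnormal_id. Qed.

Section smooth.
Variables (M B : R) (f f1 f2 : R -> R).
Hypothesis sm : smooth_test M B f f1 f2.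

Let lf : forall x y, `|f x - f y| <= 1 * `|x - y|.
Proof. by apply: lip_of_der; [exact: sm_f1 sm|exact: sm_f1_le sm]. Qed.

Let lf1 : forall x y, `|f1 x - f1 y| <= B * `|x - y|.
Proof. by apply: lip_of_der; [exact: sm_f2 sm|exact: sm_f2_le sm]. Qed.

Let lf2 x y : `|f2 x - f2 y| <= M * `|x - y|.
Proof. by have := sm_f2_lip sm y (x - y); rewrite subrKC. Qed.

Let i0 s x : intble (@stdnormal R) (fun z => f (x + s * z)).
Proof. by apply: intble_lip; exists 1. Qed.
Let i1 s x : intble (@stdnormal R) (fun z => f1 (x + s * z)).
Proof. by apply: intble_lip; exists B. Qed.
Let i2 s x : intble (@stdnormal R) (fun z => f2 (x + s * z)).
Proof. by apply: intble_lip; exists M. Qed.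

Let heat_lipschitz (g : R -> R) L s : (forall x y, `|g x - g y| <= L * `|x - y|) ->
  forall x y, `|E (fun z => g (x + s * z)) - E (fun z => g (y + s * z))| <=
    L * `|x - y|.
Proof.
move=> gL x y; apply: Ex_close => [||z].
- by apply: intble_lip; exists L.
- by apply: intble_lip; exists L.
- by rewrite (le_trans (gL _ _))// (_ : x + s * z - (y + s * z) = x - y)//; ring.
Qed.

Let heat_taylor3 s : taylor3 M (fun x => E (fun z => f (x + s * z)))
  (fun x => E (fun z => f1 (x + s * z))) (fun x => E (fun z => f2 (x + s * z))).
Proof.
split.
- move=> x b; rewrite -!addrA -!opprD.
  have -> : E (fun z => f1 (x + s * z)) * b = E (fun z => b * f1 (x + s * z)).
    by rewrite ExZ// mulrC.
  have -> : E (fun z => f2 (x + s * z)) * b ^+ 2 / 2 =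
      E (fun z => b ^+ 2 / 2 * f2 (x + s * z)).
    by rewrite ExZ//; ring.
  have iD1 := intbleZ b (i1 s x); have iD2 := intbleZ (b ^+ 2 / 2) (i2 s x).
  rewrite -ExD//; rewrite -ExD//; last exact: intbleD.
  apply: Ex_close => // [|z]; first by apply: intbleD => //; exact: intbleD.
  have := taylor_second (sm_f1 sm) (sm_f2 sm) (sm_f2_lip sm) (x + s * z) b.
  rewrite (addrAC x b); apply: le_trans; rewrite le_eqVlt; apply/orP; left.
  by apply/eqP; congr (`| _ |); ring.
- move=> x b; rewrite -!addrA -!opprD.
  have -> : E (fun z => f2 (x + s * z)) * b = E (fun z => b * f2 (x + s * z)).
    by rewrite ExZ// mulrC.
  have iD2 := intbleZ b (i2 s x).
  rewrite -ExD//.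
  apply: Ex_close => // [|z]; first exact: intbleD.
  have := taylor_first (sm_f2 sm) (sm_f2_lip sm) (x + s * z) b.
  rewrite (addrAC x b); apply: le_trans; rewrite le_eqVlt; apply/orP; left.
  by apply/eqP; congr (`| _ |); ring.
- move=> x b; apply: Ex_close => // z.
  by rewrite (addrAC x b); exact: sm_f2_lip sm _ _.
- by exists 1; exact: heat_lipschitz.
- by exists B; exact: heat_lipschitz.
- by exists M; exact: heat_lipschitz.
Qed.

(** Differentiating in the standard deviation rather than in the variance avoids the singularity of
    the square root at 0. The derivative is E[f1(x + s Z) Z], and Stein's identity turns it into s
    E[f2(x + s Z)], the heat equation in the variable s^2 / 2. *)
Let heat_der x s : is_derive s (1 : R) (fun s => E (fun z => f (x + s * z)))
  (s * E (fun z => f2 (x + s * z))).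
Proof.
have -> : s * E (fun z => f2 (x + s * z)) = E (fun z => f1 (x + s * z) * z).
  rewrite -ExZ//; apply/esym.
  apply: (@stein_identity R (fun z => f1 (x + s * z)) _ 1 (`|s| * B)).
  - move=> z; apply: is_derive_eq (der_comp (sm_f2 sm _)
      (derD (der_cst x z) (derZ s (der_id z)))) _.
    by rewrite add0r mulr1 mulrC.
  - apply: (@lip_continuous R _ (`|s| * (M * `|s|))) => y z.
    rewrite -mulrBr normrM -mulrA ler_wpM2l// (le_trans (lf2 _ _))//.
    rewrite (_ : x + s * y - (x + s * z) = s * (y - z)); last by ring.
    by rewrite normrM mulrA.
  - by move=> z; exact: sm_f1_le sm _.
  - by move=> z; rewrite normrM ler_wpM2l//; exact: sm_f2_le sm _.
have i1z : intble (@stdnormal R) (fun z => f1 (x + s * z) * z).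
  apply: (@le_intble _ (measurableTypeR R) R (@stdnormal R) _ (fun z => `|z|)).
  - by apply: measurable_funM => //; exact: intble_meas (i1 s x).
  - exact: iabs.
  - by move=> z; rewrite normrM ler_piMl//; exact: sm_f1_le sm _.
have B0 : 0 <= B by exact: le_trans (sm_f2_le sm 0).
apply: is_derive_little_o => e e0.
exists (e / (9 * B + 1)) => [|b hb]; first by rewrite divr_gt0//; lra.
have iz2 := intbleZ (B * b ^+ 2) (@stdnormal_sqr R).1.
apply: (@le_trans _ _ (E (fun z => B * b ^+ 2 * z ^+ 2))).
  have ibz := intbleZ b i1z.
  rewrite -addrA -opprD [_ * b]mulrC -ExZ// -ExD//.
  apply: Ex_close_le => //; first exact: intbleD.
  move=> z.
  have := @der_mean R (fun t => f (x + s * z + t * (b * z)))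
    (fun t => f1 (x + s * z + t * (b * z)) * (b * z)) 0 1 ler01
    (fun t => der_affine (sm_f1 sm _)).
  move=> [t /andP[t0 t1]]; rewrite mul1r mul0r addr0 subr0 mulr1 => ft.
  have -> : f (x + (s + b) * z) - (f (x + s * z) + b * (f1 (x + s * z) * z)) =
    (f1 (x + s * z + t * (b * z)) - f1 (x + s * z)) * (b * z).
    rewrite mulrBl -ft mulrDl addrA; ring.
  rewrite normrM (le_trans (ler_wpM2r (normr_ge0 _) (lf1 _ _)))//.
  rewrite addrAC subrr add0r normrM (ger0_norm t0).
  rewrite -[b ^+ 2](real_normK (num_real b)) -[z ^+ 2](real_normK (num_real z)).
  rewrite normrM -!mulrA ler_wpM2l//.
  have : 0 <= (1 - t) * (`|b| * `|z|) ^+ 2 by rewrite mulr_ge0 ?sqr_ge0//; lra.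
  lra.
rewrite ExZ; last exact: (@stdnormal_sqr R).1.
rewrite (@le_trans _ _ (B * b ^+ 2 * 9))//.
  apply: ler_wpM2l; [by rewrite mulr_ge0 ?sqr_ge0|].
  exact: (@stdnormal_sqr R).2.
move: hb; rewrite ltr_pdivlMr; last by lra.
rewrite -(real_normK (num_real b)).
have := normr_ge0 b; move: (`|b|) => c c0 hc.
have := ler_wpM2l c0 (ltW hc); have := mulr_ge0 c0 c0; lra.
Qed.

Lemma heat_family_smooth : heat_family M (heat f) (heat f1) (heat f2).
Proof.
have M0 : 0 <= M by have := lf2 1 0; rewrite subr0 normr1 mulr1; apply: le_trans.
(* For 0 <= a <= b, both (b - a)^2 and b (b - a) are at most b^2 - a^2, which is [v] here. *)
have sq (r v w : R) : 0 <= r -> 0 <= v -> 0 <= w -> v <= w ^+ 2 ->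
    [/\ 0 <= Num.sqrt r, Num.sqrt r <= Num.sqrt (r + v),
        Num.sqrt (r + v) - Num.sqrt r <= w &
        Num.sqrt (r + v) * (Num.sqrt (r + v) - Num.sqrt r) <= w ^+ 2].
  move=> r0 v0 w0 vw.
  have h0 := sqrtr_ge0 r; have h1 := sqrtr_ge0 (r + v).
  have le01 : Num.sqrt r <= Num.sqrt (r + v) by rewrite ler_wsqrtr// lerDl.
  have := sqr_sqrtr r0; have := sqr_sqrtr (addr_ge0 r0 v0).
  move: (Num.sqrt r) (Num.sqrt (r + v)) h0 h1 le01 => a b a0 b0 ab hb ha.
  have e : (b - a) * (b - a) <= w ^+ 2.
    have : 0 <= a * (b - a) by rewrite mulr_ge0//; lra.
    lra.
  have e2 : b * (b - a) <= w ^+ 2.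
    have : 0 <= a * (b - a) by rewrite mulr_ge0//; lra.
    lra.
  split=> //; have ba : 0 <= b - a by lra.
  by rewrite -(@ler_pXn2r _ 2) ?nnegrE// expr2.
split.
- by move=> r r0; exact: heat_taylor3.
- move=> r v w x r0 v0 w0 vw; have [s0 s01 sw s1w] := sq r v w r0 v0 w0 vw.
  set F2 := heat f2 r x.
  (* Subtracting F2 s^2 / 2 leaves a derivative s (E f2(x + s Z) - F2), small because the standard
     deviation moves by at most [w]. *)
  have [t /andP[t0 t1]] := der_mean s01 (fun s => derD (heat_der x s)
    (derN (derZ (F2 / 2) (derM (der_id s) (der_id s))))).
  rewrite -/(heat f (r + v) x) -/(heat f r x).
  have := sqr_sqrtr r0; have := sqr_sqrtr (addr_ge0 r0 v0).
  move: s0 s01 sw s1w t0 t1 => s0 s01 sw s1w t0 t1 h1 h0 e.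
  have -> : heat f (r + v) x - heat f r x - v / 2 * F2 =
    t * (E (fun z => f2 (x + t * z)) - F2) * (Num.sqrt (r + v) - Num.sqrt r).
    have ev : v = Num.sqrt (r + v) ^+ 2 - Num.sqrt r ^+ 2 by rewrite h1 h0; ring.
    rewrite {2}ev; move: e; rewrite -/(heat f (r + v) x) -/(heat f r x).
    move: (heat f (r + v) x) (heat f r x) (Num.sqrt (r + v)) (Num.sqrt r)
      (E (fun z => f2 (x + t * z))) F2 => u0 u1 a b u2 u3 e.
    have -> : u0 = t * (u2 - u3) * (a - b) + u1 + u3 / 2 * (a * a) -
      u3 / 2 * (b * b) by move: e; lra.
    by field.
  have d : `|E (fun z => f2 (x + t * z)) - F2| <= M * w * 3.
    apply: (@le_trans _ _ (E (fun z => M * w * `|z|))).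
      apply: Ex_close_le => //; first exact: intbleZ.
      move=> z; rewrite (le_trans (lf2 _ _))// -mulrA ler_wpM2l//.
      rewrite (_ : x + t * z - _ = (t - Num.sqrt r) * z); last by ring.
      by rewrite normrM ler_wpM2r// ger0_norm; lra.
    by rewrite ExZ// ler_wpM2l// mulr_ge0.
  rewrite !normrM.
  have tt : `|t| <= Num.sqrt (r + v) by rewrite ger0_norm//; exact: le_trans t0.
  rewrite [X in _ * X]ger0_norm ?subr_ge0//.
  apply: (@le_trans _ _ (Num.sqrt (r + v) * (M * w * 3) *
    (Num.sqrt (r + v) - Num.sqrt r))).
    by rewrite ler_wpM2r ?subr_ge0// ler_pM.
  by have := ler_wpM2l (mulr_ge0 M0 w0) s1w; lra.
- move=> r x y r0; have := heat_lipschitz (Num.sqrt r) lf x y.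
  by rewrite mul1r.
- move=> r v w x r0 v0 w0 vw; have [s0 s01 sw _] := sq r v w r0 v0 w0 vw.
  apply: (@le_trans _ _ (E (fun z => w * `|z|))).
    apply: Ex_close_le => //; first exact: intbleZ.
    move=> z; rewrite (le_trans (lf _ _))// mul1r.
    rewrite (_ : x + _ * z - _ = (Num.sqrt (r + v) - Num.sqrt r) * z); last by ring.
    by rewrite normrM ler_wpM2r// ger0_norm ?subr_ge0.
  by rewrite ExZ// mulrC ler_wpM2r.
Qed.

End smooth.

End heat.

(** * The quantile coupling *)

Lemma Ex_law d (T : measurableType d) (R : realType) (P : probability T R)
    d' (T' : measurableType d') (Q : probability T' R)
    (X : {RV P >-> R}) (U : {RV Q >-> R}) (g : R -> R) :
  (forall A : set R, measurable A -> Q (U @^-1` A) = P (X @^-1` A)) ->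
  measurable_fun setT g -> intble P (g \o X) ->
  intble Q (g \o U) /\ Ex Q (g \o U) = Ex P (g \o X).
Proof.
move=> UX mg ig.
have e (f : R -> \bar R) : measurable_fun setT f -> (forall x, 0 <= f x)%E ->
    (\int[Q]_x f (U x) = \int[P]_x f (X x))%E.
  move=> mf f0; rewrite -(ge0_integral_distribution U)//.
  rewrite -(ge0_integral_distribution X)//.
  by apply: eq_measure_integral => A mA _; exact: UX.
have mgU : measurable_fun setT (g \o U) by exact: measurableT_comp.
have ig' : intble Q (g \o U).
  apply/integrableP; split; first exact/measurable_EFinP.
  move/integrableP : ig => [_].
  by rewrite (e (fun x => `|(g x)%:E|)%E)//; apply: measurableT_comp => //;
    exact/measurable_EFinP.
split => //; have [_ e1] := Ex_distribution mg ig.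
have [_ e2] := Ex_distribution mg ig'.
apply: EFin_inj; rewrite -e1 -e2.
by apply: eq_measure_integral => A mA _; exact: UX.
Qed.

(** * Transport of a coupling to the plane *)

Section measurable_patch.
Context d (T : measurableType d) (R : realType) (m : probability T R)
  (junk : set T -> \bar R).
Hypothesis junk0 : forall A, (0 <= junk A)%E.

(* A measure is a function of all sets, with arbitrary values outside the
   sigma-algebra; equality of distributions constrains those values too. *)
Definition patch_measure (A : set T) : \bar R :=
  if `[< measurable A >] then m A else junk A.

Let patchE A : measurable A -> patch_measure A = m A.
Proof. by move=> mA; rewrite /patch_measure asboolT. Qed.

Let patch0 : patch_measure set0 = 0%E.
Proof. by rewrite patchE// measure0. Qed.

Let patch_ge0 A : (0 <= patch_measure A)%E.
Proof.
by rewrite /patch_measure; case: ifP => _; [exact: measure_ge0|exact: junk0].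
Qed.

Let patch_sigma : semi_sigma_additive patch_measure.
Proof.
move=> F mF tF mUF; rewrite patchE//.
under eq_fun do under eq_bigr do rewrite patchE//.
exact: measure_semi_sigma_additive.
Qed.

HB.instance Definition _ := isMeasure.Build _ _ _ patch_measure
  patch0 patch_ge0 patch_sigma.

Let patchT : patch_measure setT = 1%E.
Proof. by rewrite patchE// probability_setT. Qed.

HB.instance Definition _ := Measure_isProbability.Build _ _ R patch_measure patchT.

Definition patch_prob : probability T R := patch_measure.

Lemma patch_probE A : measurable A -> patch_prob A = m A.
Proof. exact: patchE. Qed.

Lemma patch_prob_junk A : ~ measurable A -> patch_prob A = junk A.
Proof. by move=> nA; rewrite /patch_prob/= /patch_measure asboolF. Qed.

End measurable_patch.

Section coupling.
Context d1 d2 d0 (T1 : measurableType d1) (T2 : measurableType d2)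
  (T0 : measurableType d0) (R : realType) (P1 : probability T1 R)
  (P2 : probability T2 R) (Q0 : probability T0 R)
  (X : {RV P1 >-> R}) (Y : {RV P2 >-> R}) (U V : {RV Q0 >-> R}).
Hypothesis UX : forall A : set R, measurable A -> Q0 (U @^-1` A) = P1 (X @^-1` A).
Hypothesis VY : forall A : set R, measurable A -> Q0 (V @^-1` A) = P2 (Y @^-1` A).

(** The hypotheses compare laws on measurable sets, whereas [wasserstein] asks for equal
    [distribution] functions on all sets. The joint law is therefore moved to the plane, where the
    coordinate projections are the coupled variables, and its values on non-measurable cylinders are
    set to those of the two given laws. *)
Lemma wasserstein_le_coupling :
  (wasserstein X Y <= \int[Q0]_x (`|U x - V x|)%:E)%E.
Proof.
have mUV : measurable_fun setT (fun x => (U x, V x)) by exact: measurable_fun_pair.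
pose UV : {RV Q0 >-> (R * R)%type} :=
  MeasurableFun.Pack (MeasurableFun.Class (isMeasurableFun.Build _ _ _ _ _ mUV)).
pose m : probability (R * R)%type R := distribution Q0 UV.
pose junk (C : set (R * R)) : \bar R :=
  if pselect (exists A, C = fst @^-1` A) is left h
  then distribution P1 X (projT1 (cid h))
  else if pselect (exists B, C = snd @^-1` B) is left h
  then distribution P2 Y (projT1 (cid h)) else 0%E.
have junk0 C : (0 <= junk C)%E.
  by rewrite /junk; case: pselect => // ?; case: pselect.
pose Q := patch_prob m junk0.
pose pr1 : {RV Q >-> R} := MeasurableFun.Pack (MeasurableFun.Class
  (isMeasurableFun.Build _ _ _ _ (fst : R * R -> R) measurable_fst)).
pose pr2 : {RV Q >-> R} := MeasurableFun.Pack (MeasurableFun.Class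
  (isMeasurableFun.Build _ _ _ _ (snd : R * R -> R) measurable_snd)).
have fst_inj (A B : set R) : fst @^-1` A = (fst @^-1` B : set (R * R)) -> A = B.
  by move=> AB; apply/seteqP; split => x Ax;
    [have : (fst @^-1` B) (x, x) by rewrite -AB|
     have : (fst @^-1` A) (x, x) by rewrite AB].
have snd_inj (A B : set R) : snd @^-1` A = (snd @^-1` B : set (R * R)) -> A = B.
  by move=> AB; apply/seteqP; split => x Ax;
    [have : (snd @^-1` B) (x, x) by rewrite -AB|
     have : (snd @^-1` A) (x, x) by rewrite AB].
(* Pulling a cylinder back along the diagonal shows that its base is measurable whenever the
   cylinder is. *)
have mdiag : measurable_fun setT (fun x : R => (x, x)).
  exact: measurable_fun_pair.
have m1 (A : set R) : measurable A -> measurable (fst @^-1` A : set (R * R)).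
  by move=> mA; rewrite -[_ @^-1` _]setTI; exact: measurable_fst.
have m2 (A : set R) : measurable A -> measurable (snd @^-1` A : set (R * R)).
  by move=> mA; rewrite -[_ @^-1` _]setTI; exact: measurable_snd.
apply: ereal_inf_lbound; exists _, (R * R)%type, Q, pr1, pr2; split.
- apply/funext => A; rewrite /distribution /pushforward /=.
  have [mA|nA] := pselect (measurable A).
    by rewrite (patch_probE m junk0); [exact: UX|exact: m1].
  rewrite (patch_prob_junk m junk0); last first.
    by move=> mfA; apply: nA; have := mdiag measurableT _ mfA; rewrite setTI.
  rewrite /junk; case: pselect => [h|]; last by case; exists A.
  by case: cid => B /= /fst_inj <-.
- apply/funext => A; rewrite /distribution /pushforward /=.
  have [mA|nA] := pselect (measurable A).
    by rewrite (patch_probE m junk0); [exact: VY|exact: m2].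
  rewrite (patch_prob_junk m junk0); last first.
    by move=> mfA; apply: nA; have := mdiag measurableT _ mfA; rewrite setTI.
  (* A cylinder in both directions is empty or the whole plane, hence measurable: the two
     prescriptions never conflict. *)
  rewrite /junk; case: pselect => [[B AB]|_].
    exfalso; apply: nA.
    have [[x Ax]|A0] := pselect (A !=set0); last first.
      by rewrite (_ : A = set0)//; apply/seteqP; split => // x Ax; apply: A0; exists x.
    rewrite (_ : A = setT)//; apply/seteqP; split => // y _.
    have : (snd @^-1` A) (y, x) by [].
    rewrite AB /= => By; have : (fst @^-1` B) (y, y) by [].
    by rewrite -AB.
  case: pselect => [h|]; last by case; exists A.
  by case: cid => B /= /snd_inj <-.
- rewrite unlock; apply/esym.
  have mk : measurable_fun setT (fun z : R * R => (`|z.1 - z.2|)%:E).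
    apply/measurable_EFinP; apply: measurableT_comp => //.
    by apply: measurable_funB; [exact: measurable_fst|exact: measurable_snd].
  rewrite (eq_measure_integral m) => [|A mA _]; last exact: patch_probE.
  by rewrite ge0_integral_distribution.
Qed.

End coupling.

(** * Quantile functions and their laws *)

Section quantile.
Context d (T : measurableType d) (R : realType) (P : probability T R)
  (X : {RV P >-> R}).
Notation mu := (@lebesgue_measure R).

Definition cdfR (t : R) : R := fine (cdf X t).

Lemma cdfRE t : (cdfR t)%:E = cdf X t.
Proof. by rewrite /cdfR fineK// fin_num_measure. Qed.

Lemma cdfR_homo : {homo cdfR : s t / s <= t}.
Proof. by move=> s t st; rewrite -lee_fin !cdfRE; exact: cdf_nondecreasing. Qed.

Lemma cdfR_bounds t : 0 <= cdfR t <= 1.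
Proof. by rewrite -!lee_fin cdfRE cdf_ge0 cdf_le1. Qed.

Let level u : set R := [set t | u <= cdfR t].

(** Off the open unit interval the level set is unbounded below or possibly empty, so the value
    there is fixed to be 0. *)
Definition quantile (u : R) : R := if 0 < u < 1 then inf (level u) else 0.

Let level_n0 u : u < 1 -> level u !=set0.
Proof.
move=> u1; have : cdfR @ +oo%R --> (1 : R) by exact/fine_cvg/cvg_cdfy1.
move=> /cvgrPdist_lt/(_ (1 - u)); rewrite subr_gt0 => /(_ u1)[t [_ ht]].
exists (t + 1); have := ht (t + 1); rewrite ltrDl ltr01 => /(_ isT)/=.
by rewrite /level/= /cdfR ltr_norml => /andP[_]; lra.
Qed.

Let level_lb u : 0 < u -> has_lbound (level u).
Proof.
move=> u0; have : cdfR @ -oo%R --> (0 : R) by exact/fine_cvg/cvg_cdfNy0.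
move=> /cvgrPdist_lt/(_ u u0)[t [_ ht]].
exists (t - 1) => s us; rewrite leNgt; apply/negP => st.
have := ht s; have ts : s < t by lra.
move=> /(_ ts)/=; rewrite ltr_norml => /andP[+ _].
by move: us; rewrite /level/= /cdfR; lra.
Qed.

(** Right continuity of the distribution function makes the infimum belong to its level set. *)
Lemma quantile_le u t : 0 < u < 1 -> (quantile u <= t) = (u <= cdfR t).
Proof.
move=> u01; have /andP[u0 u1] := u01; rewrite /quantile u01.
apply/idP/idP => [qt|ut]; last by apply: ge_inf => //; exact: level_lb.
rewrite leNgt; apply/negP => tu.
have : cdfR s @[s --> t^'+] --> cdfR t.
  by apply: fine_cvg; rewrite cdfRE; exact: cdf_right_continuous.
move=> /cvgrPdist_lt/(_ (u - cdfR t)).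
rewrite subr_gt0 => /(_ tu) [r /= r0 hr].
have hi : has_inf (level u) by split; [exact: level_n0|exact: level_lb].
have [s us str] := inf_adherent r0 hi.
have ts : t < s.
  by rewrite ltNge; apply/negP => /cdfR_homo; move: us; rewrite /level/=; lra.
have := hr s; rewrite /= ler0_norm; last by lra.
have st : - (t - s) < r by lra.
move=> /(_ st ts); rewrite ltr_norml => /andP[+ _].
by move: us; rewrite /level/= /cdfR; lra.
Qed.

Let ab01 : (0 : R) < 1. Proof. exact: ltr01. Qed.

Definition unif01 : probability (measurableTypeR R) R := uniform_prob ab01.

Let unifE A : measurable A -> unif01 A = mu (A `&` `[0, 1]).
Proof.
move=> mA; rewrite /unif01 /= /uniform_prob integral_uniform_pdf.
rewrite (eq_integral (fun=> 1%E)).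
  by rewrite integral_cst ?mul1e//; exact: measurableI.
move=> x /[!inE] -[_]; rewrite /= in_itv/= /uniform_pdf => ->.
by rewrite subr0 invr1.
Qed.

Let pre_ray t : quantile @^-1` `]t, +oo[ =
  (`]0, 1[ `&` `]cdfR t, +oo[) `|` (if t < 0 then ~` `]0, 1[ else set0).
Proof.
apply/seteqP; split => u /=; rewrite !in_itv/= !andbT.
  have [u01|u01] := boolP (0 < u < 1).
    by rewrite ltNge quantile_le// -ltNge; left.
  rewrite /quantile (negbTE u01) => t0; right; rewrite t0 /= in_itv/=.
  exact/negP.
case=> [[u01 tu]|]; first by rewrite ltNge quantile_le// -ltNge.
case: ifP => // t0; rewrite /= in_itv/= => /negP u01.
by rewrite /quantile (negbTE u01).
Qed.

Lemma measurable_quantile : measurable_fun [set: measurableTypeR R] quantile.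
Proof.
apply: (measurability _ (RGenOInfty.measurableE R)) => _ [_ [t ->] <-].
rewrite setTI pre_ray; apply: measurableU; first exact: measurableI.
by case: ifP => // _; exact: measurableC.
Qed.

(** Within the unit interval, the preimage lies between the open interval from F(t) to 1 and the
    closed one with the point 0 added. Both have length 1 - F(t), so the default value at the
    endpoints does not affect the law. *)
Let unif_ray t : unif01 (quantile @^-1` `]t, +oo[) = (1 - cdfR t)%:E.
Proof.
have mq : measurable (quantile @^-1` `]t, +oo[).
  by rewrite -[_ @^-1` _]setTI; exact: measurable_quantile.
have /andP[F0 F1] := cdfR_bounds t.
rewrite unifE//; apply/le_anti/andP; split.
  apply: (@le_trans _ _ (mu (`[cdfR t, 1] `|` [set 0]))).
    apply: le_measure; rewrite ?inE.
    - exact: measurableI.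
    - by apply: measurableU => //; exact: measurable_set1.
    rewrite pre_ray => u [+ /=]; rewrite in_itv/= => uA /andP[u0 u1].
    have [->|un0] := eqVneq u 0; first by right.
    left; rewrite /= in_itv/= u1 andbT.
    case: uA => [[_ /=]|]; first by rewrite in_itv/= andbT => /ltW.
    case: ifP => // t0; rewrite /= in_itv/= => /negP; rewrite negb_and -!leNgt.
    case/orP => h; last by rewrite (le_trans _ h).
    by move: un0; rewrite eq_le h u0.
  apply: (@le_trans _ _ (mu `[cdfR t, 1%R]%classic + mu [set 0%R])%E).
    by apply: measureU2 => //; exact: measurable_set1.
  rewrite lebesgue_measure_set1 adde0 lebesgue_measure_itv/= lte_fin.
  by case: ltP => // h; rewrite lee_fin subr_ge0.
apply: (@le_trans _ _ (mu `]cdfR t, 1[%classic)).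
  rewrite lebesgue_measure_itv/= lte_fin; case: ltP => // h.
  by rewrite lee_fin subr_le0.
apply: le_measure; rewrite ?inE//; first exact: measurableI.
rewrite pre_ray => u /=; rewrite in_itv/= => /andP[tu u1]; split.
  by left; split; rewrite /= in_itv/= ?tu// u1 andbT (le_lt_trans F0).
by rewrite /= in_itv/= (ltW u1) andbT (le_trans F0)// ltW.
Qed.

Lemma law_quantile (A : set R) : measurable A ->
  unif01 (quantile @^-1` A) = P (X @^-1` A).
Proof.
move=> mA.
pose q : {RV unif01 >-> R} := MeasurableFun.Pack (MeasurableFun.Class
  (isMeasurableFun.Build _ _ _ _ _ measurable_quantile)).
suff : distribution unif01 q A = distribution P X A by [].
pose g (n : nat) : set R := [set` `](- n%:R : R), +oo[%R].
apply: (measure_unique (@RGenOInfty.G R) g _ _ _ _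
  (distribution unif01 q) (distribution P X)) => //.
- exact: RGenOInfty.measurableE.
- move=> _ _ [x ->] [y ->]; exists (Num.max x y).
  by apply/seteqP; split => z /=; rewrite !in_itv/= !andbT gt_max => /andP.
- by move=> i; exists (- i%:R).
- apply/seteqP; split => // x _; exists (Num.truncn (- x)).+1 => //.
  by rewrite /g /= in_itv/= andbT ltrNl Num.Theory.truncnS_gt.
- move=> _ [t ->].
  transitivity (ccdf X t) => //; rewrite ccdf_1_cdf -cdfRE -EFinB.
  exact: unif_ray.
- move=> k; have gm : measurable (g k) by exact: measurable_itv.
  by apply: le_lt_trans (probability_le1 _ gm) _; exact: ltry.
Qed.

End quantile.

(** * An optimal test function for the quantile coupling *)

Section duality.
Context d1 d2 (T1 : measurableType d1) (T2 : measurableType d2) (R : realType)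
  (P1 : probability T1 R) (P2 : probability T2 R)
  (X : {RV P1 >-> R}) (Y : {RV P2 >-> R}).

(* In the quantile coupling (U, V) at level u, the distribution function of X
   is below u and that of Y at least u strictly between V and U when V < U, and
   symmetrically when U < V. Hence a primitive h of the sign of the difference
   of the distribution functions satisfies h U - h V = |U - V|. *)
Lemma wasserstein_dual : intble P1 X -> intble P2 Y ->
  exists h : R -> R, (forall x y, `|h x - h y| <= `|x - y|) /\
    (wasserstein X Y <= (Ex P1 (h \o X) - Ex P2 (h \o Y))%:E)%E.
Proof.
move=> iX iY.
pose s t : R := if cdfR X t < cdfR Y t then 1 else - 1.
have mcdf d (T : measurableType d) (P : probability T R) (W : {RV P >-> R}) :
    measurable_fun setT (cdfR W).
  by apply: nondecreasing_measurable => //; exact: cdfR_homo.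
have [||h hh] := @exists_antiderivative R s.
- by apply: measurable_fun_if => //; exact: measurable_fun_ltr.
- by exists 1 => t _; rewrite /s; case: ifP; rewrite ?normrN normr1.
have hl x y : `|h x - h y| <= `|x - y|.
  have hxy a b : a <= b -> `|h b - h a| <= `|b - a|.
    move=> ab; have /andP[h1 h2] : -1 * (b - a) <= h b - h a <= 1 * (b - a).
      by apply: hh => // t _ _; rewrite /s; case: ifP => _; apply/andP; split; lra.
    by rewrite [leRHS]ger0_norm ?subr_ge0// ler_norml; apply/andP; split; lra.
  have [xy|/ltW yx] := leP x y; last exact: hxy.
  by rewrite distrC [leRHS]distrC; exact: hxy.
exists h; split => //.
have mh : measurable_fun setT h.
  apply: continuous_measurable_fun; apply: (@lip_continuous R h 1) => x y.
  by rewrite mul1r.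
have ih d (T : measurableType d) (P : probability T R) (W : {RV P >-> R}) :
    intble P W -> intble P (h \o W).
  by apply: intble_comp; exists 1 => x y; rewrite mul1r.
pose U : {RV unif01 R >-> R} := MeasurableFun.Pack (MeasurableFun.Class
  (isMeasurableFun.Build _ _ _ _ _ (measurable_quantile X))).
pose V : {RV unif01 R >-> R} := MeasurableFun.Pack (MeasurableFun.Class
  (isMeasurableFun.Build _ _ _ _ _ (measurable_quantile Y))).
apply: (le_trans (wasserstein_le_coupling (U := U) (V := V)
  (law_quantile X) (law_quantile Y))).
have [ihU <-] := Ex_law (U := U) (law_quantile X) mh (ih _ _ _ _ iX).
have [ihV <-] := Ex_law (U := V) (law_quantile Y) mh (ih _ _ _ _ iY).
rewrite -ExB// /Ex /Rintegral fineK; last first.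
  exact: integrable_fin_num (intbleB ihU ihV).
apply: ge0_le_integral => //.
- apply/measurable_EFinP; apply: measurableT_comp => //.
  by apply: measurable_funB; exact: measurable_quantile.
- by apply/measurable_EFinP; exact: intble_meas (intbleB ihU ihV).
move=> u _; rewrite lee_fin /= /U /V /=.
have [u01|u01] := boolP (0 < u < 1); last first.
  by rewrite /quantile (negbTE u01) !subrr normr0.
(* The sign is known only strictly inside the interval, while the bound on increments asks for the
   right endpoint as well. The interval is shortened by a quarter of the supposed defect, and the
   Lipschitz bound covers the missing piece. *)
have key a b : b < a -> (forall t, b < t -> t < a -> s t = 1) -> a - b <= h a - h b.
  move=> ba s1; rewrite leNgt; apply/negP => hab.
  pose e := (a - b - (h a - h b)) / 4.
  have := hl a b; rewrite [leRHS]gtr0_norm ?subr_gt0// ler_norml => /andP[h1 h2].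
  have e0 : 0 < e by rewrite /e; lra.
  have ea : b <= a - e by rewrite /e; lra.
  have := hl a (a - e); rewrite subKr (gtr0_norm e0) ler_norml => /andP[h3 h4].
  have /andP[h5 _] : 1 * (a - e - b) <= h (a - e) - h b <= 1 * (a - e - b).
    by apply: hh => // t bt ta; rewrite s1 ?lexx//; lra.
  by move: h3 h5; rewrite /e; lra.
have key' a b : b < a -> (forall t, b < t -> t < a -> s t = -1) -> h a - h b <= b - a.
  move=> ba s1; rewrite leNgt; apply/negP => hab.
  pose e := (h a - h b - (b - a)) / 4.
  have := hl a b; rewrite [leRHS]gtr0_norm ?subr_gt0// ler_norml => /andP[h1 h2].
  have e0 : 0 < e by rewrite /e; lra.
  have ea : b <= a - e by rewrite /e; lra.
  have := hl a (a - e); rewrite subKr (gtr0_norm e0) ler_norml => /andP[h3 h4].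
  have /andP[_ h5] : -1 * (a - e - b) <= h (a - e) - h b <= -1 * (a - e - b).
    by apply: hh => // t bt ta; rewrite s1 ?lexx//; lra.
  by move: h4 h5; rewrite /e; lra.
have [VU|UV|->] := ltgtP (quantile Y u) (quantile X u); last by rewrite !subrr normr0.
- rewrite gtr0_norm ?subr_gt0//; apply: key => // t Vt tU.
  rewrite /s ifT//; apply: (@lt_le_trans _ _ u).
    by rewrite ltNge -quantile_le// -ltNge.
  by rewrite -quantile_le// ltW.
- rewrite ltr0_norm ?subr_lt0// opprB.
  have := key' _ _ UV; move=> /(_ _) h1.
  suff : h (quantile Y u) - h (quantile X u) <= quantile X u - quantile Y u by lra.
  apply: h1 => t Ut tV.
  rewrite /s ifF//; apply/negbTE; rewrite -leNgt; apply/ltW.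
  apply: (@lt_le_trans _ _ u).
    by rewrite ltNge -quantile_le// -ltNge.
  by rewrite -quantile_le// ltW.
Qed.

End duality.

(** * Sums of m-dependent variables *)

(** Smoothing at scale 8 q costs 8 q on either side. With M = 4 / (8 q)^2 and c = q^3 the exchange
    costs (51 / 8) q v + 40 q^3, which is at most 11 q because v <= 3 / 2 and q <= 2 / 15. *)
Lemma lipschitz_normal_approx d (T : measurableType d) (R : realType)
    (P : probability T R) (Y : nat -> T -> R) (q : R) (FP FF : nat -> set (set T))
    (h : R -> R) (n : nat) :
  (forall k, measurable_fun setT (Y k)) ->
  (forall k x, `|Y k x| <= q ^+ 3) ->
  (forall k, Ex P (Y k) = 0) ->
  (forall a k, (k < a)%N -> smeas (FP a) (Y k)) ->
  (forall a k, (a < k)%N -> smeas (FF a) (Y k)) ->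
  (forall a E F, <<s FP a >> E -> <<s FF a >> F -> P (E `&` F) = (P E * P F)%E) ->
  (forall k x, (k < 2)%N -> Y k x = 0) ->
  0 < q -> q <= 2 / 15 ->
  (forall x y, `|h x - h y| <= `|x - y|) ->
  let v := Ex P (fun x => seg_sum Y 0 n x ^+ 2) in v <= 3 / 2 ->
  `|Ex P (fun x => h (seg_sum Y 0 n x)) -
    Ex (@stdnormal R) (fun z => h (Num.sqrt v * z))| <= 27 * q.
Proof.
move=> mY Yc Y0 hP hF hind Y01 q0 q1 hl v v1.
have c0 : 0 < q ^+ 3 by rewrite exprn_gt0.
have e0 : 0 < 8 * q by rewrite mulr_gt0.
have v0 : 0 <= v by apply: Ex_ge0 => x; exact: sqr_ge0.
have [f [f1 [f2 [sm fh]]]] := smoothing e0 hl.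
have lh : lip h by exists 1 => x y; rewrite mul1r.
have hf := heat_family_smooth sm.
have lf : lip f.
  by exists 1; exact: lip_of_der (sm_f1 sm) (sm_f1_le sm).
have bS := bm_seg_sum mY Yc 0 n.
have h1 : `|Ex P (fun x => h (seg_sum Y 0 n x)) -
    Ex P (fun x => f (seg_sum Y 0 n x))| <= 8 * q.
  apply: Ex_close => [||x]; [exact: bm_int (bm_comp lh bS)|
    exact: bm_int (bm_comp lf bS)|by rewrite distrC].
have h3 : `|Ex (@stdnormal R) (fun z => f (0 + Num.sqrt v * z)) -
    Ex (@stdnormal R) (fun z => h (Num.sqrt v * z))| <= 8 * q.
  apply: Ex_close => [||z]; first exact: intble_lip.
    have := intble_lip (Num.sqrt v) 0 lh.
    by under eq_fun do rewrite add0r.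
  by rewrite add0r.
have := lindeberg_clt mY Yc Y0 hP hF hind c0 Y01 n hf (lexx 0).
have -> : (fun x => heat f 0 (seg_sum Y 0 n x)) =
    (fun x => f (seg_sum Y 0 n x)).
  apply/funext => x; rewrite /heat sqrtr0.
  by under [X in Ex _ X]eq_fun do rewrite mul0r addr0; rewrite Ex_cst.
rewrite add0r -/v /heat => h2.
have {h2} : `|Ex P (fun x => f (seg_sum Y 0 n x)) -
     Ex (@stdnormal R) (fun z => f (0 + Num.sqrt v * z))| <= 11 * q.
  apply: le_trans h2 _.
  have -> : 102 * (4 / (8 * q) ^+ 2) * q ^+ 3 * v = 51 / 8 * q * v.
    by field; rewrite gt_eqF.
  have q2 : q ^+ 2 <= 4 / 225.
    by have := ler_pM (ltW q0) (ltW q0) q1 q1; lra.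
  have := ler_wpM2l (ltW q0) v1; have := ler_wpM2l (ltW q0) q2; lra.
move: h1 h3; rewrite !ler_norml => /andP[? ?] /andP[? ?] /andP[? ?].
by apply/andP; split; lra.
Qed.

(** * Blocks of m consecutive variables *)

Section blocks.
Context d (T : measurableType d) (R : realType) (P : probability T R)
  (N m : nat) (X : 'I_N -> {RV P >-> R}).
Hypothesis m0 : (0 < m)%N.

Lemma sigma_family_comp (A : set 'I_N) i (g : R -> R) : A i ->
  measurable_fun setT g ->
  smeas (\bigcup_(i in A) g_sigma_algebra_preimage (X i)) (g \o X i).
Proof.
move=> Ai mg _ B mB; rewrite setTI comp_preimage.
apply: sub_sigma_algebra; exists i => //.
exists (g @^-1` B); last by rewrite setTI.
by rewrite -[_ @^-1` _]setTI; exact: mg.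
Qed.

Lemma sigma_family_indep (A B : set 'I_N) i j (g f : R -> R) :
  independent_families X A B -> A i -> B j ->
  measurable_fun setT g -> measurable_fun setT f ->
  intble P (g \o X i) -> intble P (f \o X j) ->
  Ex P (fun x => g (X i x) * f (X j x)) = Ex P (g \o X i) * Ex P (f \o X j).
Proof.
move=> ind Ai Bj mg mf ig jf.
pose U : {mfun T >-> R} := MeasurableFun.Pack (MeasurableFun.Class
  (isMeasurableFun.Build _ _ _ _ _ (intble_meas ig))).
pose V : {mfun T >-> R} := MeasurableFun.Pack (MeasurableFun.Class
  (isMeasurableFun.Build _ _ _ _ _ (intble_meas jf))).
apply: (@Ex_prod_indep _ _ _ P U V) => // C D mC mD; apply: ind.
- by have := sigma_family_comp Ai mg measurableT mC; rewrite setTI.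
- by have := sigma_family_comp Bj mf measurableT mD; rewrite setTI.
Qed.

Variable X' : 'I_N -> T -> R.

(* The first two blocks are empty, so that every cut made in [lindeberg_clt] has
   two terms to its left. *)
Definition blocks (k : nat) (x : T) : R :=
  \sum_(i < N | (i %/ m).+2 == k) X' i x.

Lemma blocks_sum x : seg_sum blocks 0 N.+2 x = \sum_(i < N) X' i x.
Proof.
have lt (i : 'I_N) : ((i %/ m).+2 < N.+2)%N.
  by rewrite !ltnS (leq_ltn_trans (leq_div _ _)).
rewrite /seg_sum big_mkord [RHS](partition_big (fun i => Ordinal (lt i)) predT)//=.
Qed.

Lemma card_block k : (#|[pred i : 'I_N | (i %/ m).+2 == k]| <= m)%N.
Proof.
pose f (i : 'I_N) : 'I_m := Ordinal (ltn_pmod i m0).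
have fi : {in [pred i : 'I_N | (i %/ m).+2 == k] &, injective f}.
  move=> i j; rewrite !inE => /eqP ik /eqP jk /(congr1 val)/= ij.
  apply: val_inj; rewrite /= (divn_eq i m) (divn_eq j m) ij.
  by congr (_ * _ + _)%N; apply: succn_inj; apply: succn_inj; rewrite ik jk.
by rewrite -(card_in_imset fi) -[X in (_ <= X)%N](card_ord m) max_card.
Qed.

Lemma blocks_le c k x : 0 <= c -> (forall i x, `|X' i x| <= c / m%:R) ->
  `|blocks k x| <= c.
Proof.
move=> c0 hX; rewrite /blocks (le_trans (ler_norm_sum _ _ _))//.
apply: (@le_trans _ _ (\sum_(i < N | (i %/ m).+2 == k) c / m%:R)).
  by apply: ler_sum => i _; exact: hX.
have m1 : 0 < m%:R :> R by rewrite ltr0n.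
apply: (@le_trans _ _ (c / m%:R * m%:R)); last by rewrite divfK ?gt_eqF.
rewrite sumr_const -[leLHS]mulr_natr.
by rewrite ler_wpM2l ?ler_nat ?card_block// divr_ge0// ltW.
Qed.

Definition past (a : nat) : set (set T) :=
  \bigcup_(i in [set i : 'I_N | ((i %/ m).+2 < a)%N]) g_sigma_algebra_preimage (X i).

Definition future (a : nat) : set (set T) :=
  \bigcup_(i in [set i : 'I_N | (a < (i %/ m).+2)%N]) g_sigma_algebra_preimage (X i).

(** Block a covers the m indices from (a - 2) m to (a - 1) m - 1, exactly the gap that m-dependence
    leaves after the index (a - 2) m - 1. For a <= 2 the past contains no variable and its
    sigma-algebra is trivial. *)
Lemma past_future_indep a E F : k_dependent m X ->
  <<s past a >> E -> <<s future a >> F -> P (E `&` F) = (P E * P F)%E.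
Proof.
move=> dep; have [a2|a2] := leqP a 2.
  have -> : past a = set0.
    rewrite /past (_ : [set i : 'I_N | _] = set0) ?bigcup_set0//.
    by apply/seteqP; split => // i /=; rewrite ltnNge (leq_trans a2).
  move=> E0 _; have : (E = set0 \/ E = setT).
    apply: (E0 [set A | A = set0 \/ A = setT]); split => //; split => /=.
    - by left.
    - by move=> A [->|->]; rewrite ?setD0 ?setDT; [right|left].
    - move=> A hA; have [[n An]|nA] := pselect (exists n, A n = setT).
        by right; apply/seteqP; split => // x _; exists n; rewrite ?An.
      left; apply/seteqP; split => // x [n _]; case: (hA n) => [->//|An].
      by case: nA; exists n.
  by case=> ->; rewrite ?set0I ?measure0 ?mul0e// setTI probability_setT mul1e.
have [j aj] : exists j, a = j.+3 by exists (a - 3)%N; move: a2; clear; lia.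
have := dep (j.+1 * m - 1)%N; rewrite /independent_families /sigma_family.
have jm : (0 < j.+1 * m)%N by rewrite muln_gt0 m0.
have -> : [set i : 'I_N | (i <= j.+1 * m - 1)%N] =
    [set i : 'I_N | ((i %/ m).+2 < a)%N].
  apply/funext => i; apply/propext; rewrite /= aj.
  rewrite -[X in _ <-> is_true X]/(i %/ m < j.+1)%N ltn_divLR//.
  by move: jm; clear; lia.
have -> : [set i : 'I_N | (j.+1 * m - 1 + m < i)%N] =
    [set i : 'I_N | (a < (i %/ m).+2)%N].
  apply/funext => i; apply/propext; rewrite /= aj.
  rewrite -[X in _ <-> is_true X]/(j.+2 <= i %/ m)%N leq_divRL//.
  by rewrite (mulSn j.+1); move: jm; clear; lia.
exact.
Qed.

End blocks.

Lemma bounded_m_dependent d (T : measurableType d) (R : realType)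
    (P : probability T R) (N m : nat) (X : 'I_N -> {RV P >-> R})
    (g : 'I_N -> R -> R) (q : R) (h : R -> R) :
  (0 < m)%N -> k_dependent m X ->
  (forall i, measurable_fun setT (g i)) ->
  (forall i x, `|g i (X i x)| <= q ^+ 3 / m%:R) ->
  (forall i, Ex P (g i \o X i) = 0) ->
  0 < q -> q <= 2 / 15 ->
  (forall x y, `|h x - h y| <= `|x - y|) ->
  let S x := \sum_(i < N) g i (X i x) in
  let v := Ex P (fun x => S x ^+ 2) in v <= 3 / 2 ->
  `|Ex P (h \o S) - Ex (@stdnormal R) (fun z => h (Num.sqrt v * z))| <= 27 * q.
Proof.
move=> m0 dep mg gb g0 q0 q1 hl S v v1.
pose X' i x := g i (X i x).
have mX' i : measurable_fun setT (X' i) by exact: measurableT_comp.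
have bX' i : bm (X' i) by split; [|exists (q ^+ 3 / m%:R) => x; exact: gb].
pose Y := blocks m X'.
have YS x : seg_sum Y 0 N.+2 x = S x by rewrite blocks_sum.
have := @lipschitz_normal_approx _ T R P Y q (past m X) (future m X) h N.+2.
rewrite (_ : (fun x => seg_sum Y 0 N.+2 x ^+ 2) = (fun x => S x ^+ 2)); last first.
  by apply/funext => x; rewrite YS.
rewrite (_ : (fun x => h (seg_sum Y 0 N.+2 x)) = h \o S); last first.
  by apply/funext => x; rewrite YS.
apply => //.
- by move=> k; apply: (bm_sum _ _).1 => i _; exact: bX'.
- by move=> k x; apply: blocks_le => //; rewrite exprn_ge0// ltW.
- move=> k; rewrite /Y /blocks Ex_sum_bm; last by move=> i _; exact: bX'.
  by apply: big1 => i _; exact: g0.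
- move=> a k ka; apply: smeas_sum => i /eqP ik.
  by apply: sigma_family_comp => //=; rewrite ik.
- move=> a k ak; apply: smeas_sum => i /eqP ik.
  by apply: sigma_family_comp => //=; rewrite ik.
- by move=> a E F; exact: past_future_indep.
- move=> k x k2; rewrite /Y /blocks big_pred0// => i.
  by rewrite gtn_eqF// (leq_trans k2).
Qed.

(** Products at distance more than m have mean zero, the others are at most half the sum of the two
    squares, and an index has at most 2 m + 1 <= 3 m neighbours, itself included. *)
Lemma m_dependent_variance d (T : measurableType d) (R : realType)
    (P : probability T R) (N m : nat) (X : 'I_N -> {RV P >-> R})
    (f : 'I_N -> R -> R) :
  (0 < m)%N -> k_dependent m X ->
  (forall i, measurable_fun setT (f i)) ->
  (forall i, intble P (fun x => f i (X i x) ^+ 2)) ->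
  (forall i, Ex P (f i \o X i) = 0) ->
  intble P (fun x => (\sum_(i < N) f i (X i x)) ^+ 2) /\
  Ex P (fun x => (\sum_(i < N) f i (X i x)) ^+ 2) <=
    3 * m%:R * \sum_(i < N) Ex P (fun x => f i (X i x) ^+ 2).
Proof.
move=> m0 dep mf if2 f0.
pose Z i x := f i (X i x).
have mZ i : measurable_fun setT (Z i) by exact: measurableT_comp.
have iZ i : intble P (Z i) by apply: intble_sqr => //; exact: if2.
have iZZ i j : intble P (fun x => Z i x * Z j x) by apply: intbleM => //; exact: if2.
have e : (fun x => (\sum_(i < N) Z i x) ^+ 2) =
    (fun x => \sum_(i < N) \sum_(j < N) Z i x * Z j x).
  apply/funext => x; rewrite expr2 mulr_suml; apply: eq_bigr => i _.
  by rewrite mulr_sumr.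
have iin i : intble P (fun x => \sum_(j < N) Z i x * Z j x).
  by apply: (Ex_sum _ _).1 => j _; exact: iZZ.
rewrite -/(Z _ _) e; split; first by apply: (Ex_sum _ _).1 => i _; exact: iin.
rewrite (Ex_sum _ _).2; last by move=> i _; exact: iin.
have es i : Ex P (fun x => \sum_(j < N) Z i x * Z j x) =
    \sum_(j < N) Ex P (fun x => Z i x * Z j x).
  by apply: (Ex_sum _ _).2 => j _; exact: iZZ.
under eq_bigr do rewrite es.
pose a i := Ex P (fun x => Z i x ^+ 2).
have a0 i : 0 <= a i by apply: Ex_ge0 => x; exact: sqr_ge0.
pose b (i j : 'I_N) : R := ((i <= j + m) && (j <= i + m))%N%:R.
have zero (i j : 'I_N) : (i + m < j)%N -> Ex P (fun x => Z i x * Z j x) = 0.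
  move=> ij.
  rewrite (sigma_family_indep (dep i) (i := i) (j := j) (leqnn i) ij)//.
    by rewrite f0 mul0r.
  - exact: iZ.
  - exact: iZ.
have hb i j : Ex P (fun x => Z i x * Z j x) <= b i j * (2^-1 * a i + 2^-1 * a j).
  rewrite /b; have [ij|ij] := leqP j (i + m); last first.
    by rewrite andbF mul0r zero.
  have [ji|ji] := leqP i (j + m); last first.
    rewrite mul0r (_ : (fun x => _) = fun x => Z j x * Z i x) ?zero//.
    by apply/funext => x; rewrite mulrC.
  rewrite mul1r /a -!ExZ//; [|exact: if2..].
  rewrite -ExD//; [|exact/intbleZ/if2..].
  apply: le_Ex => //; first by apply: intbleD; exact/intbleZ/if2.
  by move=> x; have := sqr_ge0 (Z i x - Z j x); lra.
have cb i : \sum_(j < N) b i j <= 3 * m%:R.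
  have -> : \sum_(j < N) b i j =
      #|[pred j : 'I_N | (i <= j + m) && (j <= i + m)]|%N%:R.
    by rewrite -sum1_card natr_sum [RHS]big_mkcond; apply: eq_bigr => j _;
      rewrite /b inE; case: ifP.
  rewrite -natrM ler_nat.
  pose g (j : 'I_N) : 'I_(2 * m).+1 := inord (j + m - i).
  have gi : {in [pred j : 'I_N | (i <= j + m) && (j <= i + m)]%N &, injective g}.
    move=> j k; rewrite !inE => /andP[j1 j2] /andP[k1 k2] /(congr1 val)/=.
    rewrite !inordK; [|by move: k1 k2; clear; lia|by move: j1 j2; clear; lia].
    by move=> jk; apply: val_inj => /=; move: jk j1 k1; clear; lia.
  rewrite -(card_in_imset gi) (leq_trans (max_card _))// card_ord.
  by move: m0; clear; lia.
apply: (@le_trans _ _ (\sum_(i < N) \sum_(j < N)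
    b i j * (2^-1 * a i + 2^-1 * a j))).
  by apply: ler_sum => i _; apply: ler_sum => j _; exact: hb.
have s1 : \sum_(i < N) \sum_(j < N) b i j * (2^-1 * a i) <=
    2^-1 * (3 * m%:R * \sum_(i < N) a i).
  rewrite mulr_sumr mulr_sumr; apply: ler_sum => i _; rewrite -mulr_suml.
  have := ler_wpM2r (a0 i) (cb i); lra.
have s2 : \sum_(i < N) \sum_(j < N) b i j * (2^-1 * a j) <=
    2^-1 * (3 * m%:R * \sum_(i < N) a i).
  rewrite exchange_big/=; apply: le_trans s1.
  rewrite le_eqVlt; apply/orP; left; apply/eqP.
  by apply: eq_bigr => i _; apply: eq_bigr => j _; rewrite /b andbC.
under eq_bigr do under eq_bigr do rewrite mulrDr.
under eq_bigr do rewrite big_split/=.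
rewrite big_split/=; apply: le_trans (lerD s1 s2) _.
by rewrite -/(a _); lra.
Qed.

(** The triangle inequality in L^2 for a unit vector minus a perturbation, with [k] their inner
    product and [e] the squared norm of the perturbation. The lower bound is v - (1 - r)^2 >= (r -
    k) (2 - k - r). *)
Lemma sqrt_perturbation (R : realType) (v k e r : R) :
  v = 1 - 2 * k + e -> k ^+ 2 <= e -> e <= r ^+ 2 -> 0 <= r -> r <= 1 ->
  `|Num.sqrt v - 1| <= r.
Proof.
move=> ve ke er r0 r1.
have kr : `|k| <= r.
  by rewrite -(@ler_pXn2r _ 2) ?nnegrE// real_normK ?num_real//; exact: le_trans er.
move: kr; rewrite ler_norml => /andP[k1 k2].
have h1 : (1 - r) ^+ 2 <= v.
  have : 0 <= (r - k) * (2 - k - r) by apply: mulr_ge0; lra.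
  lra.
have h2 : v <= (1 + r) ^+ 2 by lra.
have := ler_wsqrtr h1; have := ler_wsqrtr h2.
have p1 : 0 <= 1 + r by lra.
have p2 : 0 <= 1 - r by lra.
rewrite !sqrtr_sqr (ger0_norm p1) (ger0_norm p2).
by move=> ? ?; rewrite ler_norml; apply/andP; split; lra.
Qed.

Lemma cauchy_schwarz_unit d (T : measurableType d) (R : realType)
    (P : probability T R) (U V : T -> R) :
  measurable_fun setT U -> measurable_fun setT V ->
  intble P (fun x => U x ^+ 2) -> intble P (fun x => V x ^+ 2) ->
  Ex P (fun x => U x ^+ 2) = 1 ->
  Ex P (fun x => U x * V x) ^+ 2 <= Ex P (fun x => V x ^+ 2).
Proof.
move=> mU mV iU iV U1.
have iUV := intbleM mU mV iU iV.
set k := Ex P (fun x => U x * V x); set e := Ex P (fun x => V x ^+ 2).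
suff : 0 <= e - k ^+ 2 by lra.
have -> : e - k ^+ 2 = Ex P (fun x => (V x - k * U x) ^+ 2).
  rewrite (_ : (fun x => (V x - k * U x) ^+ 2) = fun x => V x ^+ 2 +
    (k ^+ 2 * U x ^+ 2 - 2 * k * (U x * V x))); last by apply/funext => x; ring.
  rewrite ExD//; last by apply: intbleB; exact: intbleZ.
  rewrite ExB//; [|exact: intbleZ..].
  by rewrite !ExZ// U1 -/k -/e; ring.
by apply: Ex_ge0 => x; exact: sqr_ge0.
Qed.

(** * Truncation and the final estimate *)

Section truncation.
Context d (T : measurableType d) (R : realType) (P : probability T R)
  (N m : nat) (X : 'I_N -> {RV P >-> R}).
Context dZ (TZ : measurableType dZ) (PZ : probability TZ R) (Z : {RV PZ >-> R}).
Hypothesis m0 : (0 < m)%N.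
Hypothesis dep : k_dependent m X.
Hypothesis mean0 : forall i, ('E_P[X i] = 0)%E.
Hypothesis mom2 : forall i, ('E_P[fun x => (X i x ^+ 2)%R] < +oo)%E.
Hypothesis var0 : (0 < 'E_P[fun x => (partial_sum X x ^+ 2)%R])%E.
Hypothesis hZ : distribution PZ Z = normal_prob 0 1.

Local Notation E := (Ex P).
Local Notation s := (sigma_sum X).

Let S x := \sum_(i < N) X i x.

Let partial_sumE x : partial_sum X x = S x.
Proof.
rewrite /partial_sum /S; elim: (index_enum _) => [|i r IH].
  by rewrite !big_nil.
by rewrite !big_cons -IH.
Qed.

Let iX2 i : intble P (fun x => X i x ^+ 2).
Proof.
have mX2 : measurable_fun setT (fun x => X i x ^+ 2) by exact: measurable_funX.
apply/integrableP; split; first exact/measurable_EFinP.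
under eq_integral do rewrite /= ger0_norm ?sqr_ge0//.
by have := mom2 i; rewrite unlock.
Qed.

Let iX i : intble P (X i).
Proof. by apply: intble_sqr. Qed.

Let EX0 i : E (X i) = 0.
Proof. by have := mean0 i; rewrite unlock /Ex /Rintegral => ->. Qed.

Let id_var := m_dependent_variance m0 dep (f := fun _ => id)
  (fun _ => @measurable_id _ _ setT) iX2 EX0.

Let iS2 : intble P (fun x => S x ^+ 2).
Proof. exact: id_var.1. Qed.

Let s2E : 0 < s /\ s ^+ 2 = E (fun x => S x ^+ 2).
Proof.
have e : ('E_P[fun x => (partial_sum X x ^+ 2)%R] = (E (fun x => S x ^+ 2))%:E)%E.
  rewrite unlock /Ex /Rintegral fineK; last exact: integrable_fin_num iS2.
  by apply: eq_integral => x _; rewrite partial_sumE.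
have := var0; rewrite /sigma_sum e lte_fin /= => h.
by rewrite sqrtr_gt0 h sqr_sqrtr// ltW.
Qed.

Let s0 : 0 < s. Proof. exact: s2E.1. Qed.
Let m1 : 0 < m%:R :> R. Proof. by rewrite ltr0n. Qed.

Section level.
Variable c : R.
Hypothesis c0 : 0 < c.

Let t : R := c / 2 * s / m%:R.

Let t0 : 0 < t.
Proof. by rewrite /t divr_gt0// mulr_gt0// divr_gt0. Qed.

Let low (y : R) : R := if `|y| <= t then y else 0.
Let high (y : R) : R := if `|y| <= t then 0 else y.

Let mlow : measurable_fun setT low.
Proof. by apply: measurable_fun_if => //; exact: measurable_fun_ler. Qed.

Let mhigh : measurable_fun setT high.
Proof. by apply: measurable_fun_if => //; exact: measurable_fun_ler. Qed.

Let low_high y : low y + high y = y.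
Proof. by rewrite /low /high; case: ifP; rewrite ?addr0 ?add0r. Qed.

Let low_le y : `|low y| <= t.
Proof. by rewrite /low; case: ifP => // _; rewrite normr0; exact: ltW t0. Qed.

Let ilow i : intble P (low \o X i).
Proof.
apply: bm_int; split; first exact: measurableT_comp.
by exists t => x; exact: low_le.
Qed.

Let ihigh2 i : intble P (fun x => high (X i x) ^+ 2).
Proof.
apply: le_intble (iX2 i) _; first exact/measurable_funX/measurableT_comp.
move=> x; rewrite ger0_norm ?sqr_ge0// /high; case: ifP => // _.
by rewrite expr0n sqr_ge0.
Qed.

Let ihigh i : intble P (high \o X i).
Proof. by apply: intble_sqr; [exact: measurableT_comp|exact: ihigh2]. Qed.

Definition tail : R :=
  m%:R / s ^+ 2 * \sum_(i < N) E (fun x => high (X i x) ^+ 2).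

Lemma UtailE : Utail X m (c / 2) = tail%:E.
Proof.
rewrite /Utail /tail [RHS]EFinM; congr (_ * _)%E.
rewrite -sumEFin; apply: eq_bigr => i _.
rewrite unlock /Ex /Rintegral fineK; last exact: integrable_fin_num (ihigh2 i).
apply: eq_integral => x _; congr EFin; rewrite indicE -/t /high.
have -> : (x \in [set y | t < `|X i y|]) = (t < `|X i x|).
  by apply/idP/idP; rewrite inE.
by rewrite ltNge; case: ifP; rewrite ?mulr0 ?expr0n ?mulr1.
Qed.

Lemma tail_ge0 : 0 <= tail.
Proof.
rewrite mulr_ge0 ?divr_ge0 ?sqr_ge0//.
by apply: sumr_ge0 => i _; apply: Ex_ge0 => x; exact: sqr_ge0.
Qed.

Let g i y := (low y - E (low \o X i)) / s.
Let k i y := (high y - E (high \o X i)) / s.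

Let S1 x := \sum_(i < N) g i (X i x).
Let S2 x := \sum_(i < N) k i (X i x).
Let W x := s^-1 * S x.

Let mg i : measurable_fun setT (g i).
Proof. by apply: measurable_funM => //; exact: measurable_funB. Qed.

Let mk i : measurable_fun setT (k i).
Proof. by apply: measurable_funM => //; exact: measurable_funB. Qed.

Let centered (f : R -> R) i : intble P (f \o X i) ->
  E ((fun y => (f y - E (f \o X i)) / s) \o X i) = 0.
Proof.
move=> fi; rewrite (_ : _ \o _ = fun x => s^-1 * ((f \o X i) x - E (f \o X i))).
  have ic : intble P (fun=> E (f \o X i)) by exact: bm_int (bm_cst _).
  by rewrite ExZ ?ExB// ?Ex_cst ?subrr ?mulr0//; exact: intbleB.
by apply/funext => x /=; rewrite mulrC.
Qed.

(** The two centrings cancel, because the original variables have mean zero. *)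
Let W_split x : W x - S2 x = S1 x.
Proof.
rewrite /W /S /S1 /S2 mulr_sumr -sumrB; apply: eq_bigr => i _.
have e : E (low \o X i) + E (high \o X i) = 0.
  rewrite -ExD// -[RHS](EX0 i); congr Ex.
  by apply/funext => y /=; rewrite low_high.
rewrite /g /k -{1}(low_high (X i x)); move: e.
move: (E (low \o X i)) (E (high \o X i)) => u w e.
have -> : u = - w by lra.
by field; rewrite gt_eqF.
Qed.

Let k2 i : intble P (fun x => k i (X i x) ^+ 2) /\
  E (fun x => k i (X i x) ^+ 2) <= E (fun x => high (X i x) ^+ 2) / s ^+ 2.
Proof.
set a := E (high \o X i).
have e : (fun x => k i (X i x) ^+ 2) = (fun x =>
    (s ^+ 2)^-1 * (high (X i x) ^+ 2 + (a ^+ 2 - 2 * a * (high \o X i) x))).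
  by apply/funext => x; rewrite /k -/a exprMn exprVn /=; ring.
have i1 := intbleZ (2 * a) (ihigh i).
have ia : intble P (fun=> a ^+ 2) by exact: bm_int (bm_cst _).
have i2 := intbleB ia i1.
rewrite e; split; first exact/intbleZ/intbleD.
rewrite ExZ; last exact: intbleD.
rewrite ExD// ExB// ExZ// Ex_cst -/a mulrC ler_wpM2r ?invr_ge0 ?sqr_ge0//.
by have := sqr_ge0 a; lra.
Qed.

Let S2_le : intble P (fun x => S2 x ^+ 2) /\ E (fun x => S2 x ^+ 2) <= 3 * tail.
Proof.
have [i2 h] := m_dependent_variance m0 dep mk (fun i => (k2 i).1)
  (fun i => centered (ihigh i)).
split => //; apply: le_trans h _.
apply: (@le_trans _ _ (3 * m%:R *
    \sum_(i < N) E (fun x => high (X i x) ^+ 2) / s ^+ 2)).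
  apply: ler_wpM2l; first by rewrite mulr_ge0.
  by apply: ler_sum => i _; exact: (k2 i).2.
rewrite -mulr_suml /tail le_eqVlt; apply/orP; left; apply/eqP; ring.
Qed.

Let mS : measurable_fun setT S.
Proof. by apply: measurable_sum => i; exact: measurable_funPT. Qed.

Let mS2 : measurable_fun setT S2.
Proof. by apply: measurable_sum => i; exact: measurableT_comp. Qed.

Let mW : measurable_fun setT W.
Proof. exact: measurable_funM. Qed.

Let iW2 : intble P (fun x => W x ^+ 2) /\ E (fun x => W x ^+ 2) = 1.
Proof.
rewrite (_ : (fun x => W x ^+ 2) = (fun x => (s ^+ 2)^-1 * S x ^+ 2)).
  split; first exact: intbleZ.
  by rewrite ExZ// -s2E.2 mulVf// gt_eqF// exprn_gt0.
by apply/funext => x; rewrite /W exprMn exprVn.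
Qed.

(** The bounded part costs 27 q, discarding [S2] costs its L^1 norm, at most r, and changing the
    standard deviation of the Gaussian to 1 costs r E|Z| <= 3 r. *)
Lemma test_function_bound (h : R -> R) (q r : R) :
  (forall x y, `|h x - h y| <= `|x - y|) ->
  0 < q -> q ^+ 3 = c -> q <= 2 / 15 ->
  0 <= r -> 3 * tail <= r ^+ 2 -> r <= 1 / 5 ->
  `|E (h \o W) - Ex (@stdnormal R) h| <= 27 * q + 4 * r.
Proof.
move=> hl q0 qc q1 r0 tr r1.
have lh : lip h by exists 1 => x y; rewrite mul1r.
have [iS2' S2t] := S2_le; have [iW W1] := iW2.
have S2r : E (fun x => S2 x ^+ 2) <= r ^+ 2 by exact: le_trans tr.
pose v := E (fun x => S1 x ^+ 2).
have gb i x : `|g i (X i x)| <= q ^+ 3 / m%:R.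
  rewrite qc /g normrM normfV (gtr0_norm s0) ler_pdivrMr//.
  (* Centring may double the truncation level, whence a truncation at half the level. *)
  have -> : c / m%:R * s = t + t by rewrite /t; field; rewrite gt_eqF.
  rewrite (le_trans (ler_normB _ _))// lerD//.
  rewrite (le_trans (Ex_norm (ilow i)))// -[leRHS](Ex_cst P).
  apply: le_Ex; [exact/intble_norm/ilow|exact: bm_int (bm_cst _)|].
  by move=> y; exact: low_le.
have iWS := intbleM mW mS2 iW iS2'.
have ve : v = 1 - 2 * E (fun x => W x * S2 x) + E (fun x => S2 x ^+ 2).
  rewrite /v (_ : (fun x => S1 x ^+ 2) = fun x => W x ^+ 2 +
    (S2 x ^+ 2 - 2 * (W x * S2 x))); last first.
    by apply/funext => x; rewrite -W_split; ring.
  have iz := intbleZ 2 iWS.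
  rewrite ExD//; last exact: intbleB.
  by rewrite ExB// ExZ// W1; ring.
have cs := cauchy_schwarz_unit mW mS2 iW iS2' W1.
have sv := sqrt_perturbation ve cs S2r r0 (le_trans r1 _).
have {}sv : `|Num.sqrt v - 1| <= r by apply: sv; lra.
have v0 : 0 <= v by apply: Ex_ge0 => x; exact: sqr_ge0.
have v1 : v <= 3 / 2.
  rewrite -(sqr_sqrtr v0); move: sv; rewrite ler_norml => /andP[_ sv].
  have : Num.sqrt v <= 6 / 5 by lra.
  have := sqrtr_ge0 v; move: (Num.sqrt v) => y y0 y1.
  have := ler_pM y0 y0 y1 y1; lra.
have h1 := bounded_m_dependent m0 dep mg gb (fun i => centered (ilow i)) q0 q1 hl v1.
have bS1 : bm S1.
  apply: bm_sum => i _; split; first exact: measurableT_comp.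
  by exists (q ^+ 3 / m%:R) => x; exact: gb.
have iS2a : intble P S2 by exact: intble_sqr.
have ihW : intble P (h \o W).
  by apply: intble_comp => //; exact: intble_sqr.
have h2 : `|E (h \o W) - E (h \o S1)| <= r.
  apply: (@le_trans _ _ (E (fun x => `|S2 x|))); last exact: Ex_norm_le.
  apply: Ex_close_le => //; [exact: bm_int (bm_comp lh bS1)|exact: intble_norm|].
  by move=> x /=; rewrite (le_trans (hl _ _))// -W_split subKr.
have h3 : `|Ex (@stdnormal R) (fun z => h (Num.sqrt v * z)) -
    Ex (@stdnormal R) h| <= r * 3.
  have il a : intble (@stdnormal R) (fun z => h (a * z)).
    by have := intble_lip a 0 lh; under eq_fun do rewrite add0r.
  have ih1 : intble (@stdnormal R) h.
    by have := il 1; under eq_fun do rewrite mul1r.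
  have iab := intble_norm (@stdnormal_id R).
  apply: (@le_trans _ _ (Ex (@stdnormal R) (fun z => r * `|id z|))).
    apply: Ex_close_le => //; first exact: intbleZ.
    move=> z; rewrite (le_trans (hl _ _))// -[X in _ - X]mul1r -mulrBl normrM.
    by rewrite ler_wpM2r.
  rewrite ExZ// ler_wpM2l//; apply: Ex_norm_le => //.
    exact: (@stdnormal_sqr R).1.
  by apply: le_trans (@stdnormal_sqr R).2 _; lra.
move: h1 h2 h3; rewrite -/v !ler_norml => /andP[? ?] /andP[? ?] /andP[? ?].
by apply/andP; split; lra.
Qed.

Lemma wasserstein_normal_bound :
  (wasserstein (normalized_sum X) Z <=
    (30 * (c `^ 3^-1 + 12 * Num.sqrt tail))%:E)%E.
Proof.
set q := c `^ 3^-1.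
have q0 : 0 < q by rewrite powR_gt0.
have q3 : q ^+ 3 = c.
  by rewrite -powR_mulrn ?powR_ge0// -powRrM mulVf// powRr1// ltW.
have [iW W1] := iW2.
have normE : (normalized_sum X : T -> R) = W.
  by apply/funext => x; rewrite /normalized_sum /= partial_sumE /W mulrC.
have iWl : intble P W by exact: intble_sqr.
have iN : intble P (normalized_sum X) by rewrite normE.
have mid : measurable_fun setT (id : measurableTypeR R -> R) by exact: measurable_id.
pose I : {RV (@stdnormal R) >-> R} := MeasurableFun.Pack (MeasurableFun.Class
  (isMeasurableFun.Build _ _ _ _ _ mid)).
have lawZ (A : set R) : measurable A -> PZ (Z @^-1` A) = @stdnormal R (I @^-1` A).
  by move=> _; have := congr1 (fun f => f A) hZ.
have iI : intble (@stdnormal R) (id \o I) by exact: stdnormal_id.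
have [iZ _] := Ex_law lawZ (@measurable_id _ _ setT) iI.
have [h [hl]] := wasserstein_dual iN iZ; move=> /le_trans; apply.
have lh : lip h by exists 1 => x y; rewrite mul1r.
have ih : intble (@stdnormal R) (h \o I).
  by have := intble_lip 1 0 lh; under eq_fun do rewrite add0r mul1r.
have mh : measurable_fun setT h.
  by apply: continuous_measurable_fun; case: lh => L; exact: lip_continuous.
have [_ ->] := Ex_law lawZ mh ih; rewrite normE lee_fin.
set u := Num.sqrt tail; have u0 : 0 <= u by exact: sqrtr_ge0.
have u2 : u ^+ 2 = tail by rewrite sqr_sqrtr// tail_ge0.
(* Outside this range the claimed bound exceeds 4, while E|W| <= 1 and E|Z| <= 3 already bound the
   distance by 4. Inside it, r = 2 u is admissible because 3 u^2 <= (2 u)^2. *)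
have [/andP[q1 u1]|big] := boolP ((q <= 2 / 15) && (u <= 1 / 90)).
  have := @test_function_bound h q (2 * u) hl q0 q3 q1.
  have h1 : 0 <= 2 * u by lra.
  have h2 : 3 * tail <= (2 * u) ^+ 2 by rewrite -u2; have := sqr_ge0 u; lra.
  have h3 : 2 * u <= 1 / 5 by lra.
  move=> /(_ h1 h2 h3); rewrite ler_norml => /andP[_].
  by rewrite (_ : h \o I = h)//; move: q0 u0; lra.
have b1 a : intble (@stdnormal R) (fun=> a) by exact: bm_int (bm_cst _).
have ihW : intble P (h \o W) by exact: intble_comp.
have hW : `|E (h \o W) - h 0| <= 1.
  rewrite -[X in _ - X](Ex_cst P); apply: (@le_trans _ _ (E (fun x => `|W x|))).
    apply: Ex_close_le => //; [exact: bm_int (bm_cst _)|exact: intble_norm|].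
    by move=> x /=; rewrite (le_trans (hl _ _))// subr0.
  by apply: Ex_norm_le => //; rewrite W1 expr1n.
have hI : `|Ex (@stdnormal R) (h \o I) - h 0| <= 3.
  rewrite -[X in _ - X](Ex_cst (@stdnormal R)).
  apply: (@le_trans _ _ (Ex (@stdnormal R) (fun x => `|id x|))).
    apply: Ex_close_le => //; first by apply: intble_norm; exact: stdnormal_id.
    by move=> x /=; rewrite (le_trans (hl _ _))// subr0.
  apply: Ex_norm_le => //; first exact: (@stdnormal_sqr R).1.
  by apply: le_trans (@stdnormal_sqr R).2 _; lra.
have qu : 4 <= 30 * (q + 12 * u).
  move: big; rewrite negb_and -!ltNge => /orP[]; lra.
move: hW hI; rewrite !ler_norml => /andP[_ ?] /andP[? _]; lra.
Qed.

End level.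
End truncation.

Theorem theorem4 (R : realType)
  (d : nat -> measure_display) (T : forall n : nat, measurableType (d n))
  (P : forall n : nat, probability (T n) R)
  (N m : nat -> nat)
  (X : forall n : nat, 'I_(N n) -> {RV (P n) >-> R})
  (hmN : forall n : nat, (1 <= n)%N -> (1 <= m n <= N n)%N)
  (hdep : forall n : nat, (1 <= n)%N -> k_dependent (m n) (X n))
  (hmean : forall n : nat, (1 <= n)%N ->
     forall i : 'I_(N n), ('E_(P n)[X n i] = 0)%E)
  (hmom2 : forall n : nat, (1 <= n)%N ->
     forall i : 'I_(N n), ('E_(P n)[fun x => (X n i x ^+ 2)%R] < +oo)%E)
  (hvar : forall n : nat, (1 <= n)%N ->
     (0 < 'E_(P n)[fun x => (partial_sum (X n) x ^+ 2)%R])%E)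
  (dZ : measure_display) (TZ : measurableType dZ) (PZ : probability TZ R)
  (Z : {RV PZ >-> R}) (hZ : distribution PZ Z = normal_prob 0 1) :
  forall (n : nat) (c : R), (1 <= n)%N -> 0 < c ->
    (wasserstein (normalized_sum (X n)) Z <=
       30%:E * ((c `^ (3^-1))%R%:E + 12%:E * (Utail (X n) (m n) (c / 2)%R `^ (2^-1)%R)))%E.
Proof.
move=> n c n1 c0; have /andP[m0 _] := hmN n n1.
have := wasserstein_normal_bound m0 (hdep n n1) (hmean n n1) (hmom2 n n1) (hvar n n1) hZ c0.
rewrite (UtailE (m n) (hmom2 n n1)) poweR_EFin powR12_sqrt//.
exact: tail_ge0.
Qed.
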